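(* The following identities of generating functions hold: $$\sum_{n=1}^\infty t^n \sum_{\pi\in\mathcal S_n} x^{p(\pi)}y^{q(\pi)}z^{\mathrm{asc}^{\rm short}(\pi)} =\sum_{n=1}^\infty t^n \sum_{M\in\mathcal N_n} x^{\mathrm{rne}(M)}y^{\mathrm{rcr}^0(M)}z^{\mathrm{lrcr}(M)}$$ $$=\sum_{m=1}^\infty\prod_{k=1}^m \frac{1}{y-1}\left[\left(1-\frac{y-1}{x-y}\left[\left(1+\frac{(x-y)t}{1-(z-y)t}\right)^k-1\right]\right)^{-1}-1\right]$$ and $$\sum_{n=1}^\infty t^n \sum_{\pi\in\mathcal S_n} s^{\mathrm{rmin}(\pi)}x^{p(\pi)}y^{q(\pi)+\mathrm{asc}^{\rm short}(\pi)}=\sum_{n=1}^\infty t^n \sum_{\pi\in\mathcal S_n} s^{\mathrm{rmin}(\pi)}x^{p_{\rm silly}(\pi)}y^{q_{\rm silly}(\pi)}$$ $$=\sum_{n=1}^\infty t^n \sum_{M\in\mathcal N_n} s^{\min(M)}x^{\mathrm{rne}(M)}y^{\mathrm{rcr}(M)}$$ $$=\sum_{m=1}^\infty\prod_{k=1}^m \frac{1}{y-1}\left[\left(1-\frac{y-1}{x-y}\left[(1+(x-y)t)^{k-1}(1+(x-y)st)-1\right]\right)^{-1}-1\right].$$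
   Context: All variables commute; the denominators $y-1$ and $x-y$ cancel formally, and the right-hand sides are power series in $t$ with polynomial coefficients. **Permutations.** $\mathcal S_n$ is the set of permutations $\pi=\pi(1)\cdots\pi(n)$ of $[n]=\{1,\dots,n\}$. An ascent is a value $\pi(j)$ with $j\ge2$ and $\pi(j-1)<\pi(j)$. $p(\pi)$ is the number of ascents $\pi(j)$ such that the value $\pi(j)-1$ occurs to the right of $\pi(j)$; $q(\pi)$ is the number of ascents $\pi(j)$ such that the value $\pi(j)-1$ occurs to the left of $\pi(j-1)$; $\mathrm{asc}^{\rm short}(\pi)$ is the number of ascents $\pi(j)$ with $\pi(j-1)=\pi(j)-1$. A silly ascent is a value $\pi(j)<n$ with $j=1$ or $\pi(j-1)<\pi(j)$. $p_{\rm silly}(\pi)$ (resp. $q_{\rm silly}(\pi)$) is the number of silly ascents $\pi(j)$ such that the value $\pi(j)+1$ occurs to the left (resp. right) of $\pi(j)$. $\mathrm{rmin}(\pi)$ is the number of values $\pi(j)$ with $\pi(j)<\pi(k)$ for all $k>j$. **Matchings.** A matching $M$ of size $n$ is a partition of $[2n]$ into 2-element arcs; an arc $A$ has opener $\mathrm{op}(A)=\min A$ and closer $\mathrm{cl}(A)=\max A$. Arcs are numbered $M_1,\dots,M_n$ by increasing closer. A left nesting is a pair of arcs $A,B$ with $\mathrm{op}(B)<\mathrm{op}(A)<\mathrm{cl}(A)<\mathrm{cl}(B)$ and $\mathrm{op}(A)=\mathrm{op}(B)+1$. $\mathcal N_n$ is the set of matchings of size $n$ with no left nesting. Put $\mathrm{Rne}(M)=\{i:\mathrm{op}(M_i)<\mathrm{op}(M_{i-1})<\mathrm{cl}(M_{i-1})=\mathrm{cl}(M_i)-1\}$,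 $\mathrm{Rcr}(M)=\{i:\mathrm{op}(M_{i-1})<\mathrm{op}(M_i)<\mathrm{cl}(M_{i-1})=\mathrm{cl}(M_i)-1\}$, $\mathrm{LRcr}(M)=\{i:\mathrm{op}(M_{i-1})+1=\mathrm{op}(M_i)<\mathrm{cl}(M_{i-1})=\mathrm{cl}(M_i)-1\}$, $\mathrm{Rcr}^0(M)=\mathrm{Rcr}(M)\setminus\mathrm{LRcr}(M)$; $\mathrm{rne},\mathrm{rcr},\mathrm{lrcr},\mathrm{rcr}^0$ are the cardinalities of $\mathrm{Rne},\mathrm{Rcr},\mathrm{LRcr},\mathrm{Rcr}^0$. $\min(M)=\#\{i:\mathrm{op}(M_i)<\mathrm{cl}(M_1)\}$. *)

(* Defs.v *)
From HB Require Import structures.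
From mathcomp Require Import all_boot all_order all_algebra all_fingroup.
From mathcomp Require Import boolp.
From mathcomp Require Import mpoly.

Set Implicit Arguments.
Unset Strict Implicit.
Unset Printing Implicit Defensive.

Import GRing.Theory.
Local Open Scope ring_scope.

(* Formal power series over R in one variable t, with R[[t]] structured as a
   commutative R-algebra in which f is invertible iff its constant coefficient
   is. Classical axioms are used only for decidable equality, choice and
   functional extensionality. *)
Record fps (R : Type) := Fps { fcoef : nat -> R }.

HB.instance Definition _ (R : Type) := gen_eqMixin (fps R).
HB.instance Definition _ (R : Type) := gen_choiceMixin (fps R).

Lemma fpsP (R : Type) (f g : fps R) : fcoef f =1 fcoef g -> f = g.
Proof. by case: f => f; case: g => g /= /funext ->. Qed.

Section FpsZmod.
Variable R : zmodType.
Implicit Types f g h : fps R.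

Definition fps_zero : fps R := Fps (fun=> 0).
Definition fps_opp f : fps R := Fps (fun n => - fcoef f n).
Definition fps_add f g : fps R := Fps (fun n => fcoef f n + fcoef g n).

Fact fps_addA : associative fps_add.
Proof. by move=> f g h; apply: fpsP => n /=; rewrite addrA. Qed.
Fact fps_addC : commutative fps_add.
Proof. by move=> f g; apply: fpsP => n /=; rewrite addrC. Qed.
Fact fps_add0 : left_id fps_zero fps_add.
Proof. by move=> f; apply: fpsP => n /=; rewrite add0r. Qed.
Fact fps_addN : left_inverse fps_zero fps_opp fps_add.
Proof. by move=> f; apply: fpsP => n /=; rewrite addNr. Qed.

HB.instance Definition _ :=
  GRing.isZmodule.Build (fps R) fps_addA fps_addC fps_add0 fps_addN.
End FpsZmod.

Section FpsRing.
Variable R : comNzRingType.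
Implicit Types f g h : fps R.

Definition fps_one : fps R := Fps (fun n => (n == 0%N)%:R).
Definition fps_mul f g : fps R :=
  Fps (fun n => \sum_(i < n.+1) fcoef f i * fcoef g (n - i)).

Fact fps_mulC : commutative fps_mul.
Proof.
move=> f g; apply: fpsP => n /=; rewrite (reindex_inj rev_ord_inj) /=.
by apply: eq_bigr => i _; rewrite subSS subKn ?leq_ord // mulrC.
Qed.

(* Associativity is inherited from truncations in {poly R}. *)
Let trunc N f : {poly R} := \poly_(i < N) fcoef f i.

Let coef_trunc_mul N f g n : (n < N)%N ->
  (trunc N f * trunc N g)`_n = fcoef (fps_mul f g) n.
Proof.
move=> ltnN; rewrite coefM; apply: eq_bigr => i _; rewrite !coef_poly.
by rewrite (leq_ltn_trans (leq_ord i) ltnN) (leq_ltn_trans (leq_subr _ _) ltnN).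
Qed.

Fact fps_mulA : associative fps_mul.
Proof.
move=> f g h; apply: fpsP => n.
have EL : (trunc n.+1 f * (trunc n.+1 g * trunc n.+1 h))`_n
    = fcoef (fps_mul f (fps_mul g h)) n.
  rewrite coefM; apply: eq_bigr => i _.
  by rewrite coef_poly ltn_ord coef_trunc_mul // ltnS leq_subr.
rewrite -EL mulrA coefM; apply: eq_bigr => i _.
by rewrite coef_trunc_mul // coef_poly ltnS leq_subr.
Qed.

Fact fps_mul1 : left_id fps_one fps_mul.
Proof.
move=> f; apply: fpsP => n /=; rewrite big_ord_recl /= mul1r subn0.
by rewrite big1 ?addr0 // => i _; rewrite mul0r.
Qed.

Fact fps_mulDl : left_distributive fps_mul +%R.
Proof.
move=> f g h; apply: fpsP => n /=; rewrite -big_split /=.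
by apply: eq_bigr => i _; rewrite mulrDl.
Qed.

Fact fps_one_neq0 : fps_one != 0.
Proof.
by apply/eqP => /(congr1 (fun f => fcoef f 0)) /eqP; rewrite /= oner_eq0.
Qed.

HB.instance Definition _ := GRing.Zmodule_isComNzRing.Build (fps R)
  fps_mulA fps_mulC fps_mul1 fps_mulDl fps_one_neq0.

Definition fps_scale (a : R) f : fps R := Fps (fun n => a * fcoef f n).

Fact fps_scaleA a b f : fps_scale a (fps_scale b f) = fps_scale (a * b) f.
Proof. by apply: fpsP => n /=; rewrite mulrA. Qed.
Fact fps_scale1 : left_id 1 fps_scale.
Proof. by move=> f; apply: fpsP => n /=; rewrite mul1r. Qed.
Fact fps_scaleDr : right_distributive fps_scale +%R.
Proof. by move=> a f g; apply: fpsP => n /=; rewrite mulrDr. Qed.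
Fact fps_scaleDl f : {morph fps_scale^~ f : a b / a + b}.
Proof. by move=> a b; apply: fpsP => n /=; rewrite mulrDl. Qed.

HB.instance Definition _ := GRing.Zmodule_isLmodule.Build R (fps R)
  fps_scaleA fps_scale1 fps_scaleDr fps_scaleDl.

Fact fps_scaleAl (a : R) f g : a *: (f * g) = a *: f * g.
Proof.
by apply: fpsP => n /=; rewrite big_distrr /=; apply: eq_bigr => i _; rewrite mulrA.
Qed.

HB.instance Definition _ := GRing.Lmodule_isLalgebra.Build R (fps R) fps_scaleAl.
HB.instance Definition _ := GRing.Lalgebra_isComAlgebra.Build R (fps R).

Definition fps_t : fps R := Fps (fun n => (n == 1%N)%:R).

End FpsRing.

Arguments fps_t {R}.

Section FpsUnit.
Variable R : comUnitRingType.
Implicit Types f g : fps R.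

(* The first n coefficients of f^-1. *)
Fixpoint fps_inv_prefix f n : seq R :=
  if n is m.+1 then
    let s := fps_inv_prefix f m in
    rcons s (if m is 0%N then (fcoef f 0)^-1
             else - (fcoef f 0)^-1 * \sum_(i < m) fcoef f (m - i) * s`_i)
  else [::].

Definition fps_unit : pred (fps R) := fun f => fcoef f 0 \is a GRing.unit.

Definition fps_inv f : fps R :=
  if fps_unit f then Fps (fun n => (fps_inv_prefix f n.+1)`_n) else f.

Let size_prefix f n : size (fps_inv_prefix f n) = n.
Proof. by elim: n => //= n IHn; rewrite size_rcons IHn. Qed.

Let nth_prefix f n i : (i < n)%N ->
  (fps_inv_prefix f n)`_i = (fps_inv_prefix f i.+1)`_i.
Proof.
elim: n => // n IHn; rewrite ltnS leq_eqVlt => /predU1P[-> //|lt_in].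
by rewrite [in LHS]/= nth_rcons size_prefix lt_in IHn.
Qed.

Fact fps_mulVf : {in fps_unit, left_inverse 1 fps_inv *%R}.
Proof.
move=> f Uf; have Uf0 : fcoef f 0 \is a GRing.unit by [].
apply: fpsP => -[|n]; rewrite /fps_inv (Uf : fps_unit f).
  by rewrite /= big_ord1 /= mulVr.
rewrite [LHS]big_ord_recr [X in _ + X = _]/= subnn.
rewrite -/(fps_inv_prefix f n.+1) nth_rcons size_prefix ltnn eqxx.
rewrite mulrAC mulNr mulVr // mulN1r.
apply/eqP; rewrite subr_eq add0r; apply/eqP/eq_bigr => i _.
by rewrite nth_prefix ?ltn_ord // mulrC.
Qed.

Fact fps_unitPl f g : g * f = 1 -> fps_unit f.
Proof.
move=> /(congr1 (fun h => fcoef h 0)); rewrite /= big_ord1 subnn => gf1.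
by apply/unitrP; exists (fcoef g 0); split; rewrite // mulrC.
Qed.

Fact fps_inv_out : {in [predC fps_unit], fps_inv =1 id}.
Proof. by move=> f /negbTE Uf; rewrite /fps_inv (Uf : fps_unit f = false). Qed.

HB.instance Definition _ :=
  GRing.ComNzRing_hasMulInverse.Build (fps R) fps_mulVf fps_unitPl fps_inv_out.

End FpsUnit.

(* \sum_(n >= 1) t^n a_n *)
Definition series1 (R : nmodType) (a : nat -> R) : fps R :=
  Fps (fun n => if n is 0%N then 0 else a n).

(* \sum_(m >= 1) F_m = S, in the t-adic topology (coefficientwise stationary
   partial sums). *)
Definition fps_sum1_eq (R : zmodType) (F : nat -> fps R) (S : fps R) : Prop :=
  forall n, exists N0, forall N, (N0 <= N)%N ->
    fcoef (\sum_(1 <= m < N.+1) F m) n = fcoef S n.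

(* The coefficients live in the fraction field of Z[x, y, z, s]. *)
Definition ratfun := {fraction {mpoly int[4]}}.
HB.instance Definition _ := GRing.Field.on ratfun.

Definition var (i : 'I_4) : ratfun := FracField.tofrac ('X_i : {mpoly int[4]}).
Definition vx : ratfun := var (inord 0).
Definition vy : ratfun := var (inord 1).
Definition vz : ratfun := var (inord 2).
Definition vs : ratfun := var (inord 3).

(* Permutations of [n] are elements of 'S_n, with positions and values both
   shifted down by 1; an ascent is identified with its position j rather than
   with its value s j. *)
Section Permutations.
Variable n : nat.
Implicit Types (s : 'S_n) (j : 'I_n).

Definition ascent s j : bool :=
  [exists i : 'I_n, (i.+1 == j :> nat) && (s i < s j)%N].

Definition perm_p s : nat :=
  #|[set j : 'I_n | ascent s j & [exists k : 'I_n, ((s k).+1 == s j :> nat) && (j < k)%N]]|.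

Definition perm_q s : nat :=
  #|[set j : 'I_n | ascent s j & [exists k : 'I_n, ((s k).+1 == s j :> nat) && (k.+1 < j)%N]]|.

Definition asc_short s : nat :=
  #|[set j : 'I_n | ascent s j & [exists i : 'I_n, (i.+1 == j :> nat) && ((s i).+1 == s j :> nat)]]|.

Definition silly_ascent s j : bool :=
  ((s j).+1 < n)%N && ((j == 0%N :> nat) || ascent s j).

Definition p_silly s : nat :=
  #|[set j : 'I_n | silly_ascent s j & [exists k : 'I_n, (s k == (s j).+1 :> nat) && (k < j)%N]]|.

Definition q_silly s : nat :=
  #|[set j : 'I_n | silly_ascent s j & [exists k : 'I_n, (s k == (s j).+1 :> nat) && (j < k)%N]]|.

Definition rmin s : nat :=
  #|[set j : 'I_n | [forall k : 'I_n, (j < k)%N ==> (s j < s k)%N]]|.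

End Permutations.

(* Matchings of size n: the ground set [2n] is 'I_(2 * n) (shifted down by 1),
   and the arcs M_1, ..., M_n are numbered from 0 to n-1. *)
Section Matchings.
Variable n : nat.
Implicit Types (A B : {set 'I_(2 * n)}) (M : {set {set 'I_(2 * n)}}).

Definition is_matching M : bool :=
  partition M [set: 'I_(2 * n)] && [forall A in M, #|A| == 2].

Definition op A : nat := \big[minn/(2 * n)%N]_(a in A) (a : nat).
Definition cl A : nat := \max_(a in A) (a : nat).

Definition left_nesting A B : bool :=
  [&& (op B < op A)%N, (op A < cl A)%N, (cl A < cl B)%N & op A == (op B).+1].

Definition no_left_nesting : {set {set {set 'I_(2 * n)}}} :=
  [set M | is_matching M & [forall A in M, forall B in M, ~~ left_nesting A B]].

Definition arc M (i : nat) : {set 'I_(2 * n)} :=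
  nth set0 (sort (fun A B => (cl A <= cl B)%N) (enum M)) i.

(* The condition cl(M_{i-1}) = cl(M_i) - 1, for an arc that has a predecessor. *)
Definition adjacent_closers M (i : 'I_n) : bool :=
  (0 < i)%N && ((cl (arc M i.-1)).+1 == cl (arc M i)).

Definition Rne M : {set 'I_n} :=
  [set i : 'I_n | adjacent_closers M i &
     (op (arc M i) < op (arc M i.-1))%N && (op (arc M i.-1) < cl (arc M i.-1))%N].

Definition Rcr M : {set 'I_n} :=
  [set i : 'I_n | adjacent_closers M i &
     (op (arc M i.-1) < op (arc M i))%N && (op (arc M i) < cl (arc M i.-1))%N].

Definition LRcr M : {set 'I_n} :=
  [set i : 'I_n | adjacent_closers M i &
     ((op (arc M i.-1)).+1 == op (arc M i)) && (op (arc M i) < cl (arc M i.-1))%N].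

Definition Rcr0 M : {set 'I_n} := Rcr M :\: LRcr M.

Definition min_stat M : nat := #|[set i : 'I_n | (op (arc M i) < cl (arc M 0))%N]|.

End Matchings.

(* Main.v *)
Require Import Defs.
From mathcomp Require Import all_boot all_order all_algebra all_fingroup.
From mathcomp Require Import mpoly.
From mathcomp Require Import ring zify.
Set Implicit Arguments.
Unset Strict Implicit.
Unset Printing Implicit Defensive.
Import GRing.Theory.
Local Open Scope ring_scope.

(** In each of the three models, write every factor [w] of the weight of an
object as [1 + (w - 1)] and replace the [1] by a catalytic variable: [a] before
the most recently inserted element and [b] after it. Inserting the new maximum
into a permutation, or appending an arc with the largest closer to a matching,
deletes one factor of this product, so the sum over all insertions telescopes
and is expressed through [f a b], [f a a], [f b b] and the boundary values of
[f]. Ordinary and silly statistics yield the same operator, and matchings yield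
the same one up to the end that carries the variable [s].

A matching without left nestings is determined by its closers, cut into
maximal runs, each closer being labelled by the run of its opener: the [k]-th
closer run is a nonempty word over [k] labels, descents, ascents and plateaus
are [rne], [rcr0] and [lrcr], and every label must occur. This last condition
is the sieve [1 + (-1)] on unused labels.

The solution of the recursion counts sequences of [m] nonempty words, the
[k]-th over [k] letters, with weights [x - 1], [y - 1], [z - 1] for descents,
ascents and plateaus. The series [V] of such words over [k] letters satisfies
[V * (x - 1 - (y - 1) * P) = P - 1], where [P] is the product over the letters
of [1 + (x - y) * u / (1 - (z - y) * u)], [u] being [t] or [s * t]; this is
symmetric in the letters, so the position of the letter marked by [s] does not
matter. *)

(** * The catalytic recursion and its solution *)

(* The letter [b] follows the letter [a]. *)
Definition step_weight (T : Type) (x y z : T) (a b : nat) : T :=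
  if (b < a)%N then x else if (a < b)%N then y else z.

Section Transfer.
Variables (R : fieldType) (x y z s : R) (e : bool).

(* [s] marks the smallest letter if [e] holds (matchings), else the largest one
   (permutations). *)
Definition marked m b := if e then b == 0%N else b.+1 == m.
Definition letter_weight m b : R := if marked m b then s else 1.
Local Notation step_weight := (step_weight x y z).

(* Sequences of [m] nonempty words of total length [n] ending with [b], letters
   being numbered by their rank among the letters available so far. *)
Fixpoint ending n m b : R :=
  if n is n'.+1 then
    letter_weight m b *
    (\sum_(a < m) ending n' m a * step_weight a b +
     \sum_(a < m.-1) ending n' m.-1 a + ((n' == 0%N) && (m == 1%N))%:R)
  else 0.

Lemma ending_large n m b : (n < m)%N -> ending n m b = 0.
Proof.
elim: n m b => //= n IHn m b ltnm.
rewrite big1 => [|a _]; last by rewrite IHn ?mul0r //; lia.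
rewrite big1 => [|a _]; last by rewrite IHn //; lia.
have -> : (n == 0%N) && (m == 1%N) = false by lia.
by rewrite !addr0 mulr0.
Qed.

(** Here [n] letters are spread over at most [n] words. If the last letter is [i] among [m.+1]
    available ones, [a] marks the [i] smaller letters and [b] the [m - i] larger ones. *)
Definition catalytic n (a b : R) :=
  \sum_(m < n) \sum_(i < m.+1) ending n m.+1 i * (a ^+ i * b ^+ (m - i)).

(** The correction by [s - 1] for appending the marked letter. On [catalytic], the values [f 0 b]
    and [f a 0] keep only the sequences that end with the smallest, respectively the largest,
    letter; there the marked letter is a plateau, of weight [z]. *)
Definition marked_insertion (f : R -> R -> R) a b : R :=
  if e then (b + x) * f b b + (z - x) * f 0 b else (a + y) * f a a + (z - y) * f a 0.

(** The multiplication by [a - b] is built in, so that the operator has no denominators: the sums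
    over appended letters are geometric and become differences of powers. *)
Definition insertion (f : R -> R -> R) a b : R :=
  a * (a + y) * f a a - b * (b + x) * f b b + (x * b - y * a + (a - b) * z) * f a b
  + (a - b) * (s - 1) * marked_insertion f a b.

(* The letters that may follow [i] when [m + 1] letters are available, in the same
   word or opening a new one. *)
Definition children m (i : nat) a b : R :=
  \sum_(j < m.+1) letter_weight m.+1 j * step_weight i j * (a ^+ j * b ^+ (m - j))
  + \sum_(j < m.+2) letter_weight m.+2 j * (a ^+ j * b ^+ (m.+1 - j)).

Lemma geometric_telescope m (a b : R) :
  (a - b) * (\sum_(j < m) a ^+ j * b ^+ (m.-1 - j)) = a ^+ m - b ^+ m.
Proof.
rewrite -(opprB (b ^+ m)) subrXX -mulNr opprB; congr (_ * _); apply: eq_bigr => j _.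
by rewrite mulrC.
Qed.

Lemma letter_weight_sum m (F : nat -> R) :
  \sum_(j < m.+1) letter_weight m.+1 j * F j =
  \sum_(j < m.+1) F j + (s - 1) * F (if e then 0%N else m).
Proof.
rewrite /letter_weight /marked; case: e.
  rewrite !big_ord_recl /= mulrBl mul1r.
  under eq_bigr do rewrite mul1r.
  by ring.
rewrite !big_ord_recr /= eqxx mulrBl mul1r.
under eq_bigr => j _ do rewrite eqSS ltn_eqF // mul1r.
by ring.
Qed.

(** Within the same word, the letters below [i] and those above [i] form two geometric sums, with
    [i] itself in the middle; the letters opening a new word form a third. All three telescope after
    multiplication by [a - b]. *)
Lemma children_insertion m i a b : (i <= m)%N ->
  (a - b) * children m i a b = insertion (fun a b => a ^+ i * b ^+ (m - i)) a b.
Proof.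
move=> leim; rewrite /children.
under eq_bigr do rewrite -mulrA.
rewrite (letter_weight_sum _ (fun j => step_weight i j * (a ^+ j * b ^+ (m - j)))).
rewrite (letter_weight_sum _ (fun j => a ^+ j * b ^+ (m.+1 - j))).
have -> : \sum_(j < m.+1) step_weight i j * (a ^+ j * b ^+ (m - j)) =
   x * b ^+ (m.+1 - i) * (\sum_(j < i) a ^+ j * b ^+ (i.-1 - j)) + z * (a ^+ i * b ^+ (m - i))
   + y * a ^+ i.+1 * (\sum_(j < m - i) a ^+ j * b ^+ ((m - i).-1 - j)).
  rewrite -(big_mkord xpredT (fun j => step_weight i j * (a ^+ j * b ^+ (m - j)))).
  rewrite (big_cat_nat (n := i)) //=; last by lia.
  rewrite [X in _ + X](big_cat_nat (n := i.+1)) //=.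
  rewrite big_nat1 /step_weight ltnn addrA; congr (_ + _ + _).
    rewrite big_mkord mulr_sumr; apply: eq_bigr => j _; rewrite ltn_ord.
    have -> : (m - j = (m.+1 - i) + (i.-1 - j))%N by have := ltn_ord j; lia.
    by rewrite exprD; ring.
  rewrite -{1}[i.+1]add0n big_addn subSS big_mkord mulr_sumr; apply: eq_bigr => j _.
  have -> : (j + i.+1 < i)%N = false by lia.
  have -> : (i < j + i.+1)%N by lia.
  have -> : (m - (j + i.+1) = (m - i).-1 - j)%N by lia.
  by rewrite exprD; ring.
have T1 := geometric_telescope i a b.
have T2 := geometric_telescope (m - i) a b.
have T3 := geometric_telescope m.+2 a b.
move: T1 T2 T3 => /=.
set S1 := \sum_(j < i) _; set S2 := \sum_(j < m - i) _; set S3 := \sum_(j < m.+2) _.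
move=> T1 T2 T3.
rewrite /insertion /marked_insertion /step_weight.
have Em (c : R) : c ^+ m = c ^+ i * c ^+ (m - i) by rewrite -exprD subnKC.
have Emi (c : R) : c ^+ (m.+1 - i) = c * c ^+ (m - i) by rewrite subSn // exprS.
rewrite !Emi.
transitivity (x * (b * b ^+ (m - i)) * ((a - b) * S1) + y * a ^+ i.+1 * ((a - b) * S2)
   + (a - b) * S3 + (a - b) * (z * (a ^+ i * b ^+ (m - i))) +
   (a - b) * (s - 1) * (step_weight i (if e then 0%N else m) * (a ^+ (if e then 0%N else m) * b ^+ (m - (if e then 0%N else m)))
    + (a ^+ (if e then 0%N else m.+1) * b ^+ (m.+1 - (if e then 0%N else m.+1))))).
  by rewrite /step_weight; ring.
rewrite T1 T2 T3 /step_weight.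
(* Powers of zero are the indicators of the last letter being smallest or largest, as needed for
   [f 0 b] and [f a 0]. *)
have Z0 : (0 : R) ^+ i = (i == 0%N)%:R by rewrite expr0n.
have Z1 : (0 : R) ^+ (m - i) = (m == i)%:R by rewrite expr0n subn_eq0 eqn_leq leim andbT.
case: e; rewrite ?subn0 ?subnn !exprS ?Z0 ?Z1 !Em /= ?expr0.
  by case: i {leim S1 T1 Em Emi T2 S2 Z0 Z1} => [|i] //=; rewrite ?expr0; ring.
move: leim Em; rewrite leq_eqVlt => /predU1P[->|ltim] Em.
  by rewrite ltnn eqxx subnn !expr0 mulr1n; ring.
by rewrite ltim ltnNge (ltnW ltim) (gtn_eqF ltim) /=; ring.
Qed.

Lemma insertion_sum I (r : seq I) (c : I -> R) (F : I -> R -> R -> R) a b :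
  insertion (fun a b => \sum_(i <- r) c i * F i a b) a b = \sum_(i <- r) c i * insertion (F i) a b.
Proof.
rewrite /insertion /marked_insertion; case: e.
all: elim: r => [|i r IHr]; first by rewrite !big_nil; ring.
all: by rewrite !big_cons -IHr; ring.
Qed.

Lemma eq_insertion (f g : R -> R -> R) a b : f =2 g -> insertion f a b = insertion g a b.
Proof. by move=> eqfg; rewrite /insertion /marked_insertion !eqfg. Qed.

Lemma catalytic1 a b : catalytic 1 a b = s.
Proof.
rewrite /catalytic !big_ord1 /= !big_ord1 big_ord0 /letter_weight /marked /=.
by case: e; rewrite mul0r eqxx !expr0; ring.
Qed.

Lemma catalyticS n a b : (0 < n)%N -> (a - b) * catalytic n.+1 a b = insertion (catalytic n) a b.
Proof.
move=> n_gt0; pose F (p : nat * nat) a b : R := a ^+ p.2 * b ^+ (p.1 - p.2).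
have -> : insertion (catalytic n) a b = \sum_(m < n) \sum_(i < m.+1)
    ending n m.+1 i * insertion (F (m : nat, i : nat)) a b.
  transitivity (insertion (fun a b => \sum_(m < n) 1 *
     (\sum_(i < m.+1) ending n m.+1 i * F (m : nat, i : nat) a b)) a b).
    by apply: eq_insertion => a' b'; apply: eq_bigr => m _; rewrite mul1r.
  rewrite insertion_sum; apply: eq_bigr => m _; rewrite mul1r.
  by rewrite insertion_sum.
transitivity ((a - b) * (\sum_(m < n) \sum_(i < m.+1) ending n m.+1 i * children m i a b)); last first.
  rewrite mulr_sumr; apply: eq_bigr => m _; rewrite mulr_sumr; apply: eq_bigr => i _.
  by rewrite mulrCA children_insertion // -ltnS.
congr (_ * _); rewrite /catalytic.
(* The last letter either continues its word or opens a new one; the start term of [ending] is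
   absent because [n] is positive. *)
have E m : \sum_(i < m.+1) ending n.+1 m.+1 i * (a ^+ i * b ^+ (m - i)) =
  \sum_(i < m.+1) ending n m.+1 i * (\sum_(j < m.+1) letter_weight m.+1 j * step_weight i j * (a ^+ j * b ^+ (m - j)))
  + \sum_(i < m) ending n m i * (\sum_(j < m.+1) letter_weight m.+1 j * (a ^+ j * b ^+ (m - j))).
  under [X in _ = X + _]eq_bigr do rewrite mulr_sumr.
  under [X in _ = _ + X]eq_bigr do rewrite mulr_sumr.
  rewrite exchange_big [X in _ = _ + X]exchange_big -big_split /=; apply: eq_bigr => j _.
  rewrite (gtn_eqF n_gt0) addr0.
  rewrite mulrDr mulrDl !mulr_sumr !mulr_suml; congr (_ + _); apply: eq_bigr => i _; ring.
under eq_bigr do rewrite E.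
(* The top term of the first sum vanishes because [n] letters cannot fill [n.+1] nonempty words; the
   second sum is shifted by one so that both are indexed by the number of words before appending. *)
rewrite big_split /= big_ord_recr /= [X in _ + X + _]big1 ?addr0; last first.
  by move=> i _; rewrite ending_large ?mul0r.
rewrite [X in _ + X]big_ord_recl /= big_ord0 add0r -big_split /=.
apply: eq_bigr => m _; rewrite -big_split /=; apply: eq_bigr => i _.
by rewrite -mulrDr.
Qed.

(** Off the diagonal, division by [a - b] determines the next term. The operator also reads diagonal
    values, which polynomiality in [b] recovers from sufficiently many other points; characteristic
    zero supplies these. *)
Lemma catalytic_unique (A : nat -> R -> R -> R) :
    [pchar R] =i pred0 ->
    (forall n a, exists q : {poly R}, forall b, A n a b = q.[b]) ->
    (forall a b, A 1 a b = s) ->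
    (forall n a b, (a - b) * A n.+2 a b = insertion (A n.+1) a b) ->
  forall n a b, A n.+1 a b = catalytic n.+1 a b.
Proof.
move=> /pcharf0P R0 polyA A1 AS; elim=> [|n IHn] a b; first by rewrite A1 catalytic1.
(* The recursion says nothing for [b = a], where polynomiality in [b] is used instead. *)
have neq c : c != a -> A n.+2 a c = catalytic n.+2 a c.
  move=> neq_ca; apply: (@mulfI _ (a - c)); first by rewrite subr_eq0 eq_sym.
  by rewrite AS catalyticS //; apply: eq_insertion.
have [q Eq] := polyA n.+2 a.
pose r := \sum_(m < n.+2) \sum_(i < m.+1) (ending n.+2 m.+1 i * a ^+ i) *: 'X^(m - i) : {poly R}.
have Er c : catalytic n.+2 a c = r.[c].
  rewrite /r horner_sum; apply: eq_bigr => m _; rewrite horner_sum; apply: eq_bigr => i _.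
  by rewrite hornerZ hornerXn mulrA.
rewrite Eq Er; congr (_.[b]); apply/eqP; rewrite -subr_eq0; apply/negPn/negP => nz.
(* There are more of these points than [q - r] can have roots; in characteristic zero they are
   distinct and none equals [a]. *)
pose pts := [seq (1 + a + k%:R) | k <- iota 0 (size (q - r)%R).+1].
suff /(max_poly_roots nz) : all (root (q - r)) [seq c <- pts | c != a].
  rewrite filter_uniq; last first.
    rewrite map_inj_uniq ?iota_uniq // => i j /addrI /eqP.
    wlog: i j / (i <= j)%N => [H|leij].
      by case/orP: (leq_total i j) => /H // H1 /[1!eq_sym] /H1.
    rewrite -subr_eq0 -opprB oppr_eq0 -natrB // R0 => /eqP; lia.
  move/(_ isT).
  have -> : [seq c <- pts | c != a] = pts.
    apply/all_filterP/allP => _ /mapP[k _ ->].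
    by rewrite -subr_eq0 addrAC addrK -(natrD _ 1) R0.
  by rewrite size_map size_iota ltnNge leqnSn.
apply/allP => c; rewrite mem_filter => /andP[/neq neq_ca _].
by rewrite rootE hornerD hornerN -Eq -Er neq_ca subrr.
Qed.
End Transfer.

(** * The series of words over weighted letters *)

(** The quantities [D k] interpolate between [c + x * T] at [k = 0] and [c + y * T] at [k = m],
    where [T] is the total. Each step divides by one factor of [P], so
    [c + x * T = P * (c + y * T)]. *)
Lemma transfer_total (A : comUnitRingType) (m : nat) (q t : nat -> A) (x y z c : A) :
    (forall b, (b < m)%N -> 1 - (z - y) * t b \is a GRing.unit) ->
    (forall b, (b < m)%N -> q b = t b * (\sum_(a < m) q a * step_weight x y z a b + c)) ->
  let P := \prod_(b < m) (1 + (x - y) * (t b / (1 - (z - y) * t b))) in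
  (\sum_(b < m) q b) * (x - y * P) = (P - 1) * c.
Proof.
move=> Ut Eq /=; set T := \sum_(b < m) q b.
pose D k := c + x * T - (x - y) * \sum_(a < k) q a.
have qD b : (b < m)%N -> q b = t b / (1 - (z - y) * t b) * D b.+1.
  move=> ltbm; have U := Ut b ltbm; apply: (mulrI U); rewrite mulrA [_ * (_ / _)]mulrC mulrVK //.
  (* [D b.+1] is the bracket in the equation for [q b] with the weight [z] of the term [a = b]
     replaced by [y]. *)
  have -> : D b.+1 = (\sum_(a < m) q a * step_weight x y z a b + c) - (z - y) * q b.
    rewrite /D -[\sum_(a < m) _](big_mkord xpredT (fun a => q a * step_weight x y z a b)).
    rewrite /T -(big_mkord xpredT q) (big_cat_nat (n := b.+1)) //= big_mkord.
    rewrite [X in _ = X + _ - _](big_cat_nat (n := b.+1)) //=.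
    rewrite [X in _ = X + _ + _ - _]big_nat_recr //=.
    rewrite [X in _ = X + _ + _ + _ - _](eq_big_nat _ _ (F2 := fun a => y * q a)); last first.
      by move=> a /andP[_ ltab]; rewrite /step_weight ltnNge ltnW //= ltab mulrC.
    rewrite [X in _ = _ + X + _ - _](eq_big_nat _ _ (F2 := fun a => x * q a)); last first.
      by move=> a /andP[ltba _]; rewrite /step_weight ltba mulrC.
    rewrite -!mulr_sumr big_mkord big_ord_recr /= /step_weight ltnn.
    by ring.
  by rewrite mulrBr -Eq //; ring.
have DP k : (k <= m)%N -> D 0%N = (\prod_(b < k) (1 + (x - y) * (t b / (1 - (z - y) * t b)))) * D k.
  elim: k => [|k IHk] lekm; first by rewrite big_ord0 mul1r.
  rewrite IHk 1?ltnW // big_ord_recr /= -mulrA; congr (_ * _).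
  rewrite mulrDl mul1r -[_ * _ * D _]mulrA -qD // /D big_ord_recr /=.
  by ring.
have := DP m (leqnn m); rewrite /D big_ord0 -/T; set P := \prod_(b < m) _ => E.
have -> : T * (x - y * P) = (c + x * T - (x - y) * 0) - P * (y * T) - c by ring.
by rewrite E; ring.
Qed.

(** * Coefficients of formal power series *)

Section FpsCoef.
Variable R : comUnitRingType.
Implicit Types f g : fps R.

Lemma fcoefD f g n : fcoef (f + g) n = fcoef f n + fcoef g n. Proof. by []. Qed.

Lemma fcoefZ a f n : fcoef (a *: f) n = a * fcoef f n. Proof. by []. Qed.

Lemma fcoef_sum I (r : seq I) (F : I -> fps R) n :
  fcoef (\sum_(i <- r) F i) n = \sum_(i <- r) fcoef (F i) n.
Proof. exact: (big_morph (fun f => fcoef f n) (fun f g => fcoefD f g n)). Qed.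

Lemma fcoef_mult f n : fcoef (fps_t * f) n = if n is n'.+1 then fcoef f n' else 0.
Proof.
case: n => [|n]; first by rewrite /= big_ord1 /= mul0r.
rewrite [LHS]big_ord_recl /= mul0r add0r big_ord_recl /= mul1r subSS subn0.
by rewrite big1 ?addr0 // => i _; rewrite mul0r.
Qed.

Lemma fcoef0M f g : fcoef (f * g) 0 = fcoef f 0 * fcoef g 0.
Proof. by rewrite [LHS]big_ord1. Qed.

Lemma fcoef0_prod I (r : seq I) (F : I -> fps R) :
  fcoef (\prod_(i <- r) F i) 0 = \prod_(i <- r) fcoef (F i) 0.
Proof. exact: (big_morph (fun f => fcoef f 0) fcoef0M). Qed.

Lemma unit_fps f : fcoef f 0 = 1 -> f \is a GRing.unit.
Proof. by move=> f1; change (fcoef f 0 \is a GRing.unit); rewrite f1 unitr1. Qed.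
End FpsCoef.

(** * Closed form of the sum over sequences of words *)

Section ClosedForm.
Variables (R : fieldType) (x y z s : R) (e : bool).
Hypotheses (neq_xy : x != y) (neq_y1 : y != 1).

Local Notation t := (@fps_t R).
Local Notation ending := (ending (x - 1) (y - 1) (z - 1) s e).

Definition letters k : fps R :=
  (1 + (x - y) *: (t / (1 - (z - y) *: t))) ^+ k.-1
  * (1 + (x - y) *: (s *: t / (1 - ((z - y) * s) *: t))).

(** The series of one nonempty word over [k] letters, with weights [x - 1], [y - 1] and [z - 1] for
    descents, ascents and plateaus. *)
Definition block_series k : fps R :=
  (y - 1)^-1 *: ((1 - ((y - 1) / (x - y)) *: (letters k - 1))^-1 - 1).

(** The last summand is the empty sequence, from which the first word starts. *)
Definition word_series m : fps R :=
  \sum_(b < m) Fps (fun n => ending n m b) + (m == 0%N)%:R.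

Lemma fcoef0_letters k : fcoef (letters k) 0 = 1.
Proof.
rewrite fcoef0M; have -> : fcoef (1 + (x - y) *: (s *: t / (1 - ((z - y) * s) *: t))) 0 = 1.
  by rewrite fcoefD [fcoef (_ *: _) 0]/= big_ord1 /= mulr0 mul0r mulr0 addr0.
rewrite mulr1 -[k.-1]card_ord -prodr_const fcoef0_prod big1 // => i _.
by rewrite fcoefD [fcoef (_ *: _) 0]/= big_ord1 /= mul0r mulr0 addr0.
Qed.

(** For a fixed number of words the recursion of [ending] is the linear system of [transfer_total].
    Its constant term is [word_series m], because a new word may follow any sequence of [m]
    words. *)
Lemma word_seriesS m : word_series m.+1 = block_series m.+1 * word_series m.
Proof.
pose tt b := letter_weight s e m.+1 b *: t.
pose q b := Fps (fun n => ending n m.+1 b).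
have dA (a b c : R) : (a - c)%:A - (b - c)%:A = (a - b)%:A :> fps R.
  by rewrite -scalerBl; congr (_ *: _); ring.
have Ut b : 1 - ((z - 1)%:A - (y - 1)%:A) * tt b \is a GRing.unit.
  by apply: unit_fps; rewrite dA mulr_algl /= !mulr0 subr0.
have Eq b : (b < m.+1)%N -> q b = tt b *
    (\sum_(a < m.+1) q a * step_weight (x - 1)%:A (y - 1)%:A (z - 1)%:A a b + word_series m).
  move=> ltbm; apply: fpsP => n; rewrite -scalerAl fcoefZ fcoef_mult.
  case: n => [|n]; first by rewrite /= mulr0.
  rewrite [LHS]/=; congr (_ * _).
  rewrite /word_series !fcoefD !fcoef_sum -addrA; congr (_ + (_ + _)); last first.
    by rewrite eqSS andbC; case: (m == 0%N); case: n.
  apply: eq_bigr => a _; rewrite /step_weight.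
  by case: ifP => _; [|case: ifP => _]; rewrite mulr_algr /= mulrC.
have /= := transfer_total (fun b _ => Ut b) Eq.
set P := \prod_(b < m.+1) _.
have -> : P = letters m.+1.
  rewrite /P; under eq_bigr do rewrite !dA !mulr_algl /tt.
  rewrite /letters /letter_weight /marked; case: e.
    rewrite big_ord_recl /= mulrC scale1r scalerA; congr (_ * _).
    by rewrite prodr_const card_ord.
  rewrite big_ord_recr /= eqxx scalerA; congr (_ * _).
  under eq_bigr => j _ do rewrite eqSS ltn_eqF // !scale1r.
  by rewrite prodr_const card_ord.
set T := \sum_(b < m.+1) _; have -> : T = word_series m.+1 by rewrite /word_series addr0.
move: (word_series m.+1) => {}T ET.
set U := 1 - ((y - 1) / (x - y)) *: (letters m.+1 - 1).
have xy : x - y != 0 by rewrite subr_eq0.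
have y1 : y - 1 != 0 by rewrite subr_eq0.
have UU : U \is a GRing.unit.
  by apply: unit_fps; rewrite /U fcoefD -scaleNr fcoefZ fcoefD fcoef0_letters /= subrr mulr0 addr0.
have EU : (x - 1)%:A - (y - 1)%:A * letters m.+1 = (x - y) *: U.
  rewrite /U scalerBr scalerA [(x - y) * (_ / _)]mulrCA divff // mulr1 mulr_algl scalerBr opprB addrA -scalerDl.
  by congr (_ *: _ + _); ring.
(* Both sides are compared after multiplication by [(x - y) *: U], which is the coefficient of the
   unknown in the solved system. *)
apply: (mulIr UU); apply: (scalerI xy); rewrite scalerAr -EU ET.
rewrite mulrAC /block_series -/U -scalerAl [(_^-1 - 1) * _]mulrBl mulVr // mul1r scalerAl; congr (_ * _).
have -> : 1 - U = ((y - 1) / (x - y)) *: (letters m.+1 - 1) by rewrite /U opprB addrC subrK.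
rewrite !scalerA -[LHS]scale1r; congr (_ *: _).
by field; rewrite xy.
Qed.

Lemma word_series_prod m : word_series m = \prod_(1 <= k < m.+1) block_series k.
Proof.
elim: m => [|m IHm]; first by rewrite /word_series big_ord0 big_geq // add0r.
by rewrite word_seriesS IHm mulrC [RHS]big_nat_recr.
Qed.

(** A sequence of [m] nonempty words has at least [m] letters, so the coefficient at [n] is
    stationary from the [n]-th partial sum on. At [a = b = 1] all monomials of [catalytic] are 1 and
    it counts the same sequences. *)
Lemma catalytic_series (a : nat -> R) :
  (forall n, a n.+1 = catalytic (x - 1) (y - 1) (z - 1) s e n.+1 1 1) ->
  fps_sum1_eq (fun m => \prod_(1 <= k < m.+1) block_series k) (series1 a).
Proof.
move=> Ea n; exists n => N lenN; under eq_bigr do rewrite -word_series_prod.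
rewrite fcoef_sum -{1}[N.+1]addn1 -{1}[1%N]add0n big_addn addnK big_mkord.
have E m : fcoef (word_series (m + 1)) n = \sum_(b < m.+1) ending n m.+1 b.
  by rewrite addn1 /word_series fcoefD fcoef_sum addr0.
under eq_bigr do rewrite E.
case: n lenN {E} => [|n] lenN; first by rewrite big1 // => m _; rewrite big1.
rewrite [RHS](_ : _ = a n.+1) // Ea /catalytic.
rewrite -(big_mkord xpredT (fun m => \sum_(b < m.+1) ending n.+1 m.+1 b)).
rewrite (big_cat_nat (n := n.+1)) // [X in _ + X = _]big_nat_cond.
rewrite [X in _ + X = _]big1 ?addr0; last first.
  by move=> m /andP[/andP[ltnm _] _]; rewrite big1 // => b _; apply: ending_large.
rewrite big_mkord; apply: eq_bigr => m _; apply: eq_bigr => b _.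
by rewrite !expr1n !mulr1.
Qed.
End ClosedForm.

(** * Permutations *)

(** Factors with [b] are turned into factors with [a] one at a time; changing factor [i] contributes
    [a - b] times the product without it. *)
Lemma removed_factor_telescope (R : comNzRingType) (g : nat -> R) (a b : R) lo hi : (lo <= hi)%N ->
  (a - b) * (\sum_(lo <= i < hi)
     (\prod_(lo <= j < i) (a + g j)) * \prod_(i.+1 <= j < hi) (b + g j)) =
  \prod_(lo <= j < hi) (a + g j) - \prod_(lo <= j < hi) (b + g j).
Proof.
elim: hi => [|hi IHhi]; first by rewrite leqn0 => /eqP->; rewrite !big_geq // mulr0 subrr.
rewrite leq_eqVlt => /predU1P[->|lelohi]; first by rewrite !big_geq // mulr0 subrr.
rewrite big_nat_recr // [X in _ = X - _]big_nat_recr // [X in _ = _ - X]big_nat_recr //= (big_geq (leqnn hi.+1)) mulr1 mulrDr.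
under eq_big_nat => i /andP[_ lt_i] do rewrite big_nat_recr // mulrA.
by rewrite -mulr_suml mulrA IHhi //; ring.
Qed.

(** * The insertion operator on products over positions *)

Section GapInsertion.
Variables (R : fieldType) (x y z s : R).

(** Here [pos] and [i] are the positions of the old and the new maximum, and [g] gives the gap
    weights. The insertion replaces the factor at [i] by [b] and creates an ascent at the new
    maximum, whose weight depends on [pos]. The sum telescopes on either side of [pos]. *)
Lemma perm_insertion (g : nat -> R) n pos (a b : R) :
    (pos <= n)%N -> ((pos < n)%N -> g pos.+1 = 0) ->
  (a - b) * (\sum_(0 <= i < n.+2)
     (if i == n.+1 then s else 1) *
     ((if i == 0%N then 1 else
         a + (if (i <= pos)%N then x else if i == pos.+1 then z else y)) *
      (if i == n.+1 then 1 else b) *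
      (\prod_(1 <= j < i) (a + g j) * \prod_(i.+1 <= j < n.+1) (b + g j)))) =
  insertion x y z s false
    (fun a b => \prod_(1 <= j < pos.+1) (a + g j) * \prod_(pos.+1 <= j < n.+1) (b + g j)) a b.
Proof.
move=> lepn g0; pose A c := \prod_(1 <= j < pos.+1) (c + g j).
pose B c := \prod_(pos.+1 <= j < n.+1) (c + g j).
have TA := removed_factor_telescope g a b (isT : 1 <= pos.+1)%N.
have TB := removed_factor_telescope g a b (lepn : pos.+1 <= n.+1)%N.
rewrite -/(A a) -/(A b) in TA; rewrite -/(B a) -/(B b) in TB.
rewrite /insertion /marked_insertion -!/(A _) -!/(B _).
have sum_split (F : nat -> R) : \sum_(0 <= i < n.+2) F i =
    F 0%N + (\sum_(1 <= i < pos.+1) F i + \sum_(pos.+1 <= i < n.+1) F i) + F n.+1.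
  by rewrite big_nat_recr // big_ltn // (big_cat_nat (n := pos.+1)).
rewrite sum_split !eqxx /=.
have split c i : (i <= pos.+1)%N -> \prod_(i <= j < n.+1) (c + g j) =
    \prod_(i <= j < pos.+1) (c + g j) * B c by move=> lei; rewrite (big_cat_nat (n := pos.+1)).
have split1 c i : (pos.+1 <= i)%N -> \prod_(1 <= j < i) (c + g j) =
    A c * \prod_(pos.+1 <= j < i) (c + g j) by move=> lei; rewrite (big_cat_nat (n := pos.+1)).
rewrite [X in _ + (X + _) + _](eq_big_nat _ _ (F2 := fun i => (a + x) * b * B b *
    ((\prod_(1 <= j < i) (a + g j)) * \prod_(i.+1 <= j < pos.+1) (b + g j)))); last first.
  move=> i /andP[i_gt0 ltip]; rewrite ltn_eqF ?(gtn_eqF i_gt0) 1?ltip 1?split; [|lia..].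
  by rewrite -ltnS ltip; ring.
rewrite -mulr_sumr.
rewrite [X in _ + (_ + X) + _](eq_big_nat _ _ (F2 := fun i => (a + y) * b * A a *
    ((\prod_(pos.+1 <= j < i) (a + g j)) * \prod_(i.+1 <= j < n.+1) (b + g j)) +
    (if i == pos.+1 then (z - y) * A a * B b else 0))); last first.
  move=> i /andP[ltpi ltin]; rewrite ltn_eqF // gtn_eqF 1?[(i <= pos)%N]leqNgt ?ltpi /=; last by lia.
  rewrite split1 //; case: eqP => [Ei|_]; last by ring.
  have ltpn : (pos < n)%N by lia.
  by rewrite Ei /B [X in _ = _ + _ * X]big_ltn // g0 // addr0 (big_geq (leqnn pos.+1)); ring.
rewrite big_split /= -mulr_sumr.
(* Insertion right after the old maximum creates a short ascent. If [pos = n] this happens at the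
   end, in the term [i = n.+1] already split off. *)
have -> : \sum_(pos.+1 <= i < n.+1) (if i == pos.+1 then (z - y) * A a * B b else 0) =
   if (pos < n)%N then (z - y) * A a * B b else 0.
  case: ifP => [ltpn|gepn]; last by rewrite big_geq //; lia.
  rewrite big_ltn ?ltnS // eqxx big_nat_cond big1 ?addr0 // => i /andP[/andP[lti _] _].
  by rewrite gtn_eqF.
rewrite (big_geq (leqnSn n.+1)) (big_geq (leq0n 1)) (split b 1%N) // -/(A b).
rewrite (split1 a n.+1) // -/(B a).
move: TA TB; set SA := (X in (a - b) * X = _) => TA; set SB := (X in (a - b) * X = _) => TB.
rewrite -/SA -/SB.
transitivity ((a - b) * b * A b * B b + (a + x) * b * B b * ((a - b) * SA)
   + (a + y) * b * A a * ((a - b) * SB)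
   + (a - b) * (if (pos < n)%N then (z - y) * A a * B b else 0)
   + (a - b) * s * (a + (if (n < pos)%N then x else if n.+1 == pos.+1 then z else y)) * A a * B a).
  by ring.
rewrite TA TB eqSS [(n < pos)%N]ltnNge lepn /=.
case: (ltngtP pos n) lepn => // [ltpn|Epn] _.
  by rewrite [B 0]big_ltn // g0 //; ring.
by rewrite /B Epn !big_geq //; ring.
Qed.

(** The product on the right omits the old maximum. Once the new maximum is placed, [g'] gives the
    old one weight [y] if the new one is to its right and [x] otherwise. Short ascents are not
    singled out, hence the second [y] in the operator. *)
Lemma silly_insertion (g : nat -> R) n pos (a b : R) : (pos <= n)%N ->
  let g' i j := if j == pos then (if (pos < i)%N then y else x) else g j in
  (a - b) * (\sum_(0 <= i < n.+2)
     (if i == n.+1 then s else 1) *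
     ((if i == n.+1 then 1 else b) *
      (\prod_(0 <= j < i) (a + g' i j) * \prod_(i.+1 <= j < n.+1) (b + g' i j)))) =
  insertion x y y s false
    (fun a b => \prod_(0 <= j < pos) (a + g j) * \prod_(pos.+1 <= j < n.+1) (b + g j)) a b.
Proof.
move=> lepn g'; pose A c := \prod_(0 <= j < pos) (c + g j).
pose B c := \prod_(pos.+1 <= j < n.+1) (c + g j).
have TA := removed_factor_telescope g a b (leq0n pos).
have TB := removed_factor_telescope g a b (lepn : pos.+1 <= n.+1)%N.
rewrite -/(A a) -/(A b) in TA; rewrite -/(B a) -/(B b) in TB.
rewrite /insertion /marked_insertion -!/(A _) -!/(B _).
have g'g c i lo hi : (hi <= pos)%N || (pos < lo)%N ->
    \prod_(lo <= j < hi) (c + g' i j) = \prod_(lo <= j < hi) (c + g j).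
  move=> out; apply: eq_big_nat => j /andP[lej ltj]; rewrite /g'.
  by have -> : (j == pos) = false by lia.
have split c i k : (i <= pos)%N -> \prod_(i <= j < n.+1) (c + g' k j) =
    \prod_(i <= j < pos) (c + g j) * (c + (if (pos < k)%N then y else x)) * B c.
  move=> lei; rewrite (big_cat_nat (n := pos)) //; last by lia.
  rewrite /= [X in _ * X]big_ltn // mulrA !g'g ?leqnn ?orbT //.
  by rewrite {1}/g' eqxx.
have split1 c i k : (pos < i)%N -> \prod_(0 <= j < i) (c + g' k j) =
    A c * (c + (if (pos < k)%N then y else x)) * \prod_(pos.+1 <= j < i) (c + g j).
  move=> lei; rewrite (big_cat_nat (n := pos)) //; last by lia.
  rewrite /= [X in _ * X]big_ltn // mulrA !g'g ?leqnn ?orbT //.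
  by rewrite {1}/g' eqxx.
have sum_split (F : nat -> R) : \sum_(0 <= i < n.+2) F i =
    \sum_(0 <= i < pos) F i + (F pos + \sum_(pos.+1 <= i < n.+1) F i) + F n.+1.
  rewrite big_nat_recr // (big_cat_nat (n := pos)) //=; last by lia.
  by rewrite [X in _ + X + _]big_ltn.
rewrite sum_split !eqxx /=.
rewrite [X in X + _ + _](eq_big_nat _ _ (F2 := fun i => (b + x) * b * B b *
    ((\prod_(0 <= j < i) (a + g j)) * \prod_(i.+1 <= j < pos) (b + g j)))); last first.
  move=> i /andP[_ ltip]; rewrite ltn_eqF; last by lia.
  rewrite split ?g'g; [|lia..].
  have -> : (pos < i)%N = false by lia.
  by ring.
rewrite -mulr_sumr.
rewrite [X in _ + (_ + X) + _](eq_big_nat _ _ (F2 := fun i => (a + y) * b * A a *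
    ((\prod_(pos.+1 <= j < i) (a + g j)) * \prod_(i.+1 <= j < n.+1) (b + g j)))); last first.
  move=> i /andP[ltpi ltin]; rewrite ltn_eqF //.
  rewrite split1 // g'g; last by lia.
  by rewrite ltpi; ring.
rewrite -mulr_sumr.
rewrite (big_geq (leqnSn n.+1)) (split1 a n.+1) // !g'g ?leqnn ?ltnSn ?orbT //.
rewrite ltn_eqF ?ltnS // lepn -/(A a) -/(B b) -/(B a).
move: TA TB; set SA := (X in (a - b) * X = _) => TA; set SB := (X in (a - b) * X = _) => TB.
rewrite -/SA -/SB.
transitivity ((b + x) * b * B b * ((a - b) * SA) + (a - b) * b * A a * B b
   + (a + y) * b * A a * ((a - b) * SB) + (a - b) * s * (a + y) * A a * B a).
  by ring.
by rewrite TA TB; ring.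
Qed.
End GapInsertion.

(** * Insertion of a new maximum into a permutation *)

Section MaxInsertion.
Local Open Scope nat_scope.

(** The position of the maximum and the order of the other entries can be read off the result, so
    insertion is injective; it is bijective by cardinality. *)
Lemma sum_lift_perm_max (V : nmodType) n (F : 'S_n.+1 -> V) :
  (\sum_p F p = \sum_(p : 'S_n) \sum_(i < n.+1) F (lift_perm i ord_max p))%R.
Proof.
rewrite pair_bigA (reindex (fun u : 'S_n * 'I_n.+1 => lift_perm u.2 ord_max u.1)) //=.
apply: onW_bij; apply: inj_card_bij; last first.
  by rewrite card_prod card_ord !card_Sn factS mulnC.
move=> [p i] [p' i'] /= E.
have Ei : i = i'.
  by apply: (@perm_inj _ (lift_perm i ord_max p)); rewrite lift_perm_id E lift_perm_id.
rewrite -Ei in E *; congr (_, _); apply/permP => j; apply: (@lift_inj _ ord_max).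
by rewrite -!(lift_perm_lift i) E.
Qed.

Definition max_pos n (p : 'S_n.+1) : 'I_n.+1 := (p^-1)%g ord_max.

Lemma max_pos_lift n (p : 'S_n) i : max_pos (lift_perm i ord_max p) = i.
Proof. by apply: (@perm_inj _ (lift_perm i ord_max p)); rewrite permKV lift_perm_id. Qed.

Lemma max_posP n (p : 'S_n.+1) k : (p k == n :> nat) = (k == max_pos p).
Proof.
apply/eqP/eqP => [E|->]; last by rewrite permKV.
by apply: (@perm_inj _ p); rewrite permKV; apply: val_inj.
Qed.

Lemma lift_perm_max_val n (p : 'S_n) (i : 'I_n.+1) (j : 'I_n) : lift_perm i ord_max p (lift i j) = p j :> nat.
Proof. by rewrite lift_perm_lift lift_max. Qed.

(** The entry that comes to follow the new maximum is no longer an ascent; every other old entry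
    keeps its predecessor. *)
Lemma ascent_lift n (p : 'S_n) (i : 'I_n.+1) (j : 'I_n) :
  ascent (lift_perm i ord_max p) (lift i j) = (j != i :> nat) && ascent p j.
Proof.
apply/existsP/andP => [[k]|[neq_ji /existsP[k /andP[/eqP Ek lt_pk]]]].
  rewrite lift_perm_max_val; case: (unliftP i k) => [k'|] ->.
    rewrite lift_perm_max_val => /andP[/eqP /= Ek lt_pk]; split.
      by move: Ek; rewrite /bump; lia.
    apply/existsP; exists k'; rewrite lt_pk andbT.
    by move: Ek; rewrite /bump; lia.
  rewrite lift_perm_id /= => /andP[_]; have := ltn_ord (p j); lia.
exists (lift i k); rewrite !lift_perm_max_val lt_pk andbT /= /bump.
by apply/eqP; move: neq_ji Ek; lia.
Qed.

Lemma ascent_max n (p : 'S_n) (i : 'I_n.+1) : ascent (lift_perm i ord_max p) i = (0 < i).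
Proof.
apply/existsP/idP => [[k /andP[/eqP <-]] //|i_gt0].
have lt_i : i.-1 < n by have := ltn_ord i; lia.
exists (lift i (Ordinal lt_i)); rewrite lift_perm_max_val lift_perm_id /= ltn_ord andbT.
by rewrite /bump; lia.
Qed.

(** The new maximum is a right-to-left minimum only in the last position, and it is never smaller
    than an entry to its left. *)
Lemma rmin_lift n (p : 'S_n) (i : 'I_n.+1) :
  rmin (lift_perm i ord_max p) = (i == n :> nat) + rmin p.
Proof.
rewrite /rmin -!sum1dep_card big_mkcond (bigD1_ord i) //=; congr (_ + _).
  have -> : [forall k : 'I_n.+1, (i < k) ==>
      (lift_perm i ord_max p i < lift_perm i ord_max p k)] = (i == n :> nat).
    apply/forallP/eqP => [H|Ei k]; last by have := ltn_ord k; rewrite Ei; lia.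
    apply/eqP; rewrite eqn_leq -ltnS ltn_ord leqNgt; apply/negP => lt_in.
    have := H (lift i (Ordinal lt_in)); rewrite lift_perm_max_val lift_perm_id /= /bump leqnn.
    by rewrite add1n ltnSn /=; have := ltn_ord (p (Ordinal lt_in)); lia.
  by case: eqP.
rewrite [RHS]big_mkcond; apply: eq_bigr => j _; congr (if _ then _ else _).
apply/forallP/forallP => H k.
  by have := H (lift i k); rewrite !lift_perm_max_val /= /bump; move: (p j < p k); lia.
case: (unliftP i k) => [k'|] ->; last first.
  by rewrite lift_perm_id lift_perm_max_val /= ltn_ord implybT.
by have := H k'; rewrite !lift_perm_max_val /= /bump; move: (p j < p k'); lia.
Qed.
End MaxInsertion.

(** * Ordinary ascent statistics of permutations *)

Section GapWeights.
Variables (R : fieldType) (x y z s : R).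

(** With the arguments [x - 1], [y - 1] and [z - 1], the factor [1 + gap_weight p j] is the
    contribution of position [j] to the weight of [p]. *)
Definition gap_weight n (p : 'S_n) (j : 'I_n) : R :=
  if ascent p j then
    if [exists k : 'I_n, ((p k).+1 == p j :> nat) && (j < k)%N] then x
    else if [exists k : 'I_n, ((p k).+1 == p j :> nat) && (k.+1 < j)%N] then y else z
  else 0.

Lemma gap_weight_lift n (p : 'S_n) (i : 'I_n.+1) (j : 'I_n) :
  gap_weight (lift_perm i ord_max p) (lift i j) = if j == i :> nat then 0 else gap_weight p j.
Proof.
rewrite /gap_weight ascent_lift; case: eqP => //= /eqP neq_ji; case: ifP => // _.
have E (P : rel nat) : (forall k : 'I_n, P (lift i j) (lift i k) = P j k) ->
  [exists k : 'I_n.+1, ((lift_perm i ord_max p k).+1 == lift_perm i ord_max p (lift i j) :> nat) && P (lift i j) k]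
  = [exists k : 'I_n, ((p k).+1 == p j :> nat) && P j k].
  move=> EP; apply/existsP/existsP => -[k]; last first.
    by move=> H; exists (lift i k); rewrite !lift_perm_max_val EP.
  case: (unliftP i k) => [k'|] ->; rewrite lift_perm_max_val.
    by rewrite lift_perm_max_val EP; exists k'.
  by rewrite lift_perm_id /=; have := ltn_ord (p j); lia.
have /= -> := E (fun a b => a < b)%N; last by move=> k; rewrite /= /bump; lia.
have /= -> // := E (fun a b => b.+1 < a)%N.
by move=> k; move: neq_ji; rewrite /= /bump; lia.
Qed.

(** The value one below the new maximum is the old maximum, so the position of the latter decides
    the type of the ascent. *)
Lemma gap_weight_max n (p : 'S_n.+1) (i : 'I_n.+2) : (0 < i)%N ->
  gap_weight (lift_perm i ord_max p) i =
  if (i <= max_pos p)%N then x else if i == (max_pos p).+1 :> nat then z else y.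
Proof.
move=> i_gt0; rewrite /gap_weight ascent_max i_gt0.
have E (P : rel nat) :
  [exists k : 'I_n.+2, ((lift_perm i ord_max p k).+1 == lift_perm i ord_max p i :> nat) && P i k]
  = P i (lift i (max_pos p)).
  apply/existsP/idP => [[k]|H]; last first.
    exists (lift i (max_pos p)).
    by rewrite H lift_perm_max_val lift_perm_id (eqP (_ : p (max_pos p) == n :> nat)) ?max_posP ?eqxx.
  case: (unliftP i k) => [k'|] ->; rewrite lift_perm_id; last by rewrite -[X in X == _]addn1 -[X in _ == X]addn0 eqn_add2l.
  by rewrite lift_perm_max_val /= eqSS max_posP => /andP[/eqP->].
have /= -> := E (fun a b => a < b)%N; have /= -> := E (fun a b => b.+1 < a)%N.
rewrite /bump; case: (leqP i (max_pos p)) => [le|lt].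
  by have -> : (i < true + max_pos p)%N by lia.
rewrite add0n; have -> : (i < max_pos p)%N = false by lia.
by case: eqP => [->|neq]; [rewrite ltnn|have -> : ((max_pos p).+1 < i)%N by lia].
Qed.
End GapWeights.

Section PermCatalytic.
Variables (R : fieldType) (x y z s : R).
Local Notation gap_weight := (gap_weight x y z).

Definition perm_prod n (p : 'S_n.+1) (a b : R) : R :=
  \prod_(j : 'I_n.+1 | (0 < j)%N) ((if (j <= max_pos p)%N then a else b) + gap_weight p j).

Lemma perm_prodE n (p : 'S_n.+1) a b :
  let g j := gap_weight p (inord j) in
  perm_prod p a b = \prod_(1 <= j < (max_pos p).+1) (a + g j) *
                    \prod_((max_pos p).+1 <= j < n.+1) (b + g j).
Proof.
move=> g; pose F j := (if (j <= max_pos p)%N then a else b) + g j.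
transitivity (\prod_(1 <= j < n.+1) F j).
  by rewrite big_geq_mkord /=; apply: eq_bigr => j _; rewrite /F /g inord_val.
rewrite (big_cat_nat (n := (max_pos p).+1)) //; congr (_ * _).
  by apply: eq_big_nat => j /andP[_ ltj]; rewrite /F -ltnS ltj.
by apply: eq_big_nat => j /andP[ltj _]; rewrite /F leqNgt ltj.
Qed.

Lemma perm_prod_lift n (p : 'S_n.+1) (i : 'I_n.+2) a b :
  let g j := gap_weight p (inord j) in
  perm_prod (lift_perm i ord_max p) a b =
  (if i == 0%N :> nat then 1 else
     a + (if (i <= max_pos p)%N then x else if i == (max_pos p).+1 :> nat then z else y)) *
  (if i == n.+1 :> nat then 1 else b) *
  (\prod_(1 <= j < i) (a + g j) * \prod_(i.+1 <= j < n.+1) (b + g j)).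
Proof.
move=> g; rewrite /perm_prod max_pos_lift big_mkcond (bigD1_ord i) //= -mulrA; congr (_ * _).
  by case: ltngtP => // i_gt0; rewrite leqnn gap_weight_max.
pose F j := if (0 < bump i j)%N then
  (if (bump i j <= i)%N then a else b) + (if j == i then 0 else g j) else 1.
transitivity (\prod_(0 <= j < n.+1) F j).
  by rewrite big_mkord; apply: eq_bigr => j _; rewrite /F gap_weight_lift /g inord_val.
rewrite (big_cat_nat (n := i)) ?leq_ord //.
have -> : \prod_(0 <= j < i) F j = \prod_(1 <= j < i) (a + g j).
  case: (posnP i) => [->|i_gt0]; first by rewrite !big_geq.
  rewrite big_ltn // {1}/F /bump leqn0 (gtn_eqF i_gt0) /= mul1r.
  apply: eq_big_nat => j /andP[j_gt0 ltji]; rewrite /F /bump [(i <= j)%N]leqNgt ltji /= add0n j_gt0.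
  by rewrite (ltnW ltji) (ltn_eqF ltji).
rewrite mulrCA; congr (_ * _); case: eqP => [->|/eqP neq_in].
  by rewrite !big_geq // mulr1.
have ltin : (i < n.+1)%N by have := ltn_ord i; lia.
rewrite /= big_ltn // {1}/F /bump leqnn /= add1n ltnn eqxx addr0; congr (_ * _).
apply: eq_big_nat => j /andP[ltij _]; rewrite /F /bump (ltnW ltij) add1n /=.
by rewrite ltnNge (ltnW ltij) /= (gtn_eqF ltij).
Qed.

Lemma ascent_after_max n (p : 'S_n.+1) : (max_pos p < n)%N ->
  gap_weight p (inord (max_pos p).+1) = 0.
Proof.
move=> ltpn; rewrite /gap_weight; case: ifP => // /existsP[k /andP[/eqP Ek]].
move: Ek; rewrite inordK // => -[Ek].
have -> : p k = n :> nat by apply/eqP; rewrite max_posP; apply/eqP/val_inj.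
by rewrite ltnNge -ltnS ltn_ord.
Qed.

Definition perm_catalytic n (a b : R) : R :=
  if n is n'.+1 then \sum_(p : 'S_n'.+1) s ^+ rmin p * perm_prod p a b else 0.

Lemma perm_catalyticS n a b :
  (a - b) * perm_catalytic n.+2 a b = insertion x y z s false (perm_catalytic n.+1) a b.
Proof.
rewrite /= sum_lift_perm_max insertion_sum mulr_sumr; apply: eq_bigr => p _.
rewrite (eq_insertion _ _ _ _ _ _ _ (perm_prodE p)) /=.
rewrite -perm_insertion ?leq_ord //; last exact: ascent_after_max.
rewrite mulrCA; congr (_ * _); rewrite big_mkord mulr_sumr; apply: eq_bigr => i _.
rewrite rmin_lift perm_prod_lift exprD mulrAC mulrC; congr (_ * _).
rewrite !mulrA; congr (_ * _ * _ * _ * _).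
by case: eqP; rewrite ?expr0 ?expr1.
Qed.

Lemma perm_catalytic1 a b : perm_catalytic 1 a b = s.
Proof.
rewrite /= (bigD1 1%g) //= big1 ?addr0 => [|p /eqP[]]; last first.
  by apply/permP => i; rewrite !ord1.
rewrite /perm_prod big1 ?mulr1 => [|j]; last by rewrite ord1.
rewrite -[RHS]expr1; congr (_ ^+ _).
rewrite /rmin -[RHS](card_ord 1) -cardsT; apply: eq_card => j; rewrite !inE.
by apply/forallP => k; rewrite !ord1.
Qed.

Lemma perm_catalytic_poly n a : exists q : {poly R}, forall b, perm_catalytic n a b = q.[b].
Proof.
case: n => [|n]; first by exists 0 => b; rewrite horner0.
exists (\sum_(p : 'S_n.+1) (s ^+ rmin p) *:
   \prod_(j : 'I_n.+1 | (0 < j)%N) ((if (j <= max_pos p)%N then a%:P else 'X) + (gap_weight p j)%:P)) => b.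
rewrite horner_sum; apply: eq_bigr => p _; rewrite hornerZ horner_prod; congr (_ * _).
by apply: eq_bigr => j _; rewrite hornerD hornerC; case: ifP; rewrite ?hornerC ?hornerX.
Qed.
End PermCatalytic.

Lemma prod_indicator (R : comNzRingType) (I : finType) (A : {set I}) (c : R) :
  \prod_i (if i \in A then c else 1) = c ^+ #|A|.
Proof. by rewrite -big_mkcond prodr_const. Qed.

Section PermWeight.
Variables (R : fieldType) (x y z : R).

(** At an ascent the value one less exists and has a unique position [k]; exactly one of [j < k],
    [k.+1 < j] and [k.+1 = j] holds. *)
Lemma perm_prod1 n (p : 'S_n.+1) :
  perm_prod (x - 1) (y - 1) (z - 1) p 1 1 = x ^+ perm_p p * y ^+ perm_q p * z ^+ asc_short p.
Proof.
rewrite /perm_p /perm_q /asc_short -!prod_indicator -!big_split /= /perm_prod big_mkcond.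
apply: eq_bigr => j _; rewrite !inE if_same /gap_weight.
case Aj: (ascent p j); last by rewrite addr0 if_same /= !mulr1.
have /existsP[i /andP[/eqP Ei lt_pi]] := Aj.
rewrite -{1}Ei /=.
have lt_k : ((p j).-1 < n.+1)%N by have := ltn_ord (p j); lia.
pose k := (p^-1)%g (Ordinal lt_k); have Ek : ((p k).+1 = p j)%N by rewrite permKV /=; lia.
have uniqk k' : ((p k').+1 == p j :> nat) = (k' == k).
  rewrite -Ek eqSS; apply/eqP/eqP => [E|-> //]; apply: (@perm_inj _ p); exact: val_inj.
have E (P : pred 'I_n.+1) : [exists k', ((p k').+1 == p j :> nat) && P k'] = P k.
  apply/existsP/idP => [[k']|Pk]; first by rewrite uniqk => /andP[/eqP->].
  by exists k; rewrite uniqk eqxx.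
rewrite !E.
have -> : [exists i0 : 'I_n.+1, (i0.+1 == j :> nat) && ((p i0).+1 == p j :> nat)] = (k.+1 == j :> nat).
  by rewrite -(E (fun k => k.+1 == j :> nat)); apply: eq_existsb => k'; rewrite andbC.
have neq_kj : k != j :> nat by apply/negP => /eqP/val_inj kj; move: Ek; rewrite kj; lia.
have -> : (k.+1 == j) = ~~ (j < k)%N && ~~ (k.+1 < j)%N by lia.
case: (ltnP j k) => [ltjk|lekj] /=; last by case: ifP => _ /=; ring.
have -> : (k.+1 < j)%N = false by lia.
by rewrite /=; ring.
Qed.
End PermWeight.

Lemma perm_sum_catalytic (R : fieldType) (x y z s : R) n : [pchar R] =i pred0 ->
  \sum_(p : 'S_n.+1) s ^+ rmin p * (x ^+ perm_p p * y ^+ perm_q p * z ^+ asc_short p) =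
  catalytic (x - 1) (y - 1) (z - 1) s false n.+1 1 1.
Proof.
move=> R0; rewrite -(catalytic_unique (A := perm_catalytic (x - 1) (y - 1) (z - 1) s)) //.
- by apply: eq_bigr => p _; rewrite perm_prod1.
- exact: perm_catalytic_poly.
- exact: perm_catalytic1.
- exact: perm_catalyticS.
Qed.

(** * Silly ascent statistics of permutations *)

Section SillyCatalytic.
Variables (R : fieldType) (x y s : R).

Definition silly_weight n (p : 'S_n) (j : 'I_n) : R :=
  if silly_ascent p j then
    if [exists k : 'I_n, (p k == (p j).+1 :> nat) && (k < j)%N] then x else y
  else 0.

(* The type of the old maximum as a silly ascent is decided by the position of the
   new one, hence the factor at [max_pos] is left out of [silly_prod]. *)
Lemma silly_weight_lift n (p : 'S_n.+1) (i : 'I_n.+2) (j : 'I_n.+1) :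
  silly_weight (lift_perm i ord_max p) (lift i j) =
  if j == i :> nat then 0 else
  if j == max_pos p then (if (max_pos p < i)%N then y else x) else silly_weight p j.
Proof.
rewrite /silly_weight.
have -> : silly_ascent (lift_perm i ord_max p) (lift i j) =
    (j != i :> nat) && ((j == 0%N :> nat) || ascent p j).
  rewrite /silly_ascent ascent_lift lift_perm_max_val ltnS ltn_ord /=.
  by rewrite /bump; case: (ascent p j); rewrite ?andbT ?andbF ?orbF ?orbT; lia.
case: eqP => //= /eqP neq_ji.
have E k' : ((lift_perm i ord_max p k' == (lift_perm i ord_max p (lift i j)).+1 :> nat) && (k' < lift i j)%N)
  = if unlift i k' is Some k then (p k == (p j).+1 :> nat) && (k < j)%N
    else (j == max_pos p) && (i < lift i j)%N.
  case: (unliftP i k') => [k|] ->; rewrite !lift_perm_max_val.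
    by congr (_ && _); rewrite /= /bump; lia.
  by rewrite lift_perm_id /= eqSS -max_posP [n == _]eq_sym.
under eq_existsb do rewrite E.
case: (j =P max_pos p) => [Ej|/eqP neq_jm].
  (* The old maximum exceeds its predecessor, if any, so it becomes a silly ascent unless the new
     maximum is inserted directly before it. *)
  have asc : (j == 0%N :> nat) || ascent p j.
    case: posnP => //= j_gt0; have lt_j : (j.-1 < n.+1)%N by have := ltn_ord j; lia.
    apply/existsP; exists (Ordinal lt_j); rewrite prednK // eqxx /=.
    have -> : p j = n :> nat by apply/eqP; rewrite max_posP Ej.
    rewrite ltn_neqAle -ltnS ltn_ord andbT max_posP -Ej -val_eqE /=; lia.
  rewrite asc; case: (ltnP (max_pos p) i) => [ltmi|leim].
    case: existsP => // -[k']; case: unliftP => [k _|_ /andP[_]].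
      have -> : p j = n :> nat by apply/eqP; rewrite max_posP Ej.
      by rewrite ltn_eqF // ltn_ord.
    by rewrite /= /bump Ej; lia.
  case: existsP => // -[]; exists i; rewrite unlift_none /= /bump Ej.
  by rewrite Ej in neq_ji; lia.
have -> : silly_ascent p j = (j == 0%N :> nat) || ascent p j.
  rewrite /silly_ascent; suff -> : ((p j).+1 < n.+1)%N by [].
  by have := ltn_ord (p j); have := max_posP p j; rewrite (negbTE neq_jm); lia.
case: ifP => // _; congr (if _ then _ else _); apply/existsP/existsP => -[k].
  by case: unliftP => // k' _; exists k'.
by exists (lift i k); rewrite liftK.
Qed.

Definition silly_prod n (p : 'S_n.+1) (a b : R) : R :=
  \prod_(j : 'I_n.+1 | j != max_pos p) ((if (j <= max_pos p)%N then a else b) + silly_weight p j).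

Lemma silly_prodE n (p : 'S_n.+1) a b :
  let g j := silly_weight p (inord j) in
  silly_prod p a b = \prod_(0 <= j < max_pos p) (a + g j) *
                     \prod_((max_pos p).+1 <= j < n.+1) (b + g j).
Proof.
move=> g; pose F j := if j == max_pos p :> nat then 1 else (if (j <= max_pos p)%N then a else b) + g j.
transitivity (\prod_(0 <= j < n.+1) F j).
  rewrite /silly_prod big_mkord big_mkcond; apply: eq_bigr => j _.
  by rewrite /F /g inord_val -val_eqE /=; case: eqP.
rewrite (big_cat_nat (n := max_pos p)) ?leq_ord //=; last exact: ltnW.
rewrite [X in _ * X = _]big_ltn // {2}/F eqxx mul1r.
congr (_ * _); apply: eq_big_nat => j; rewrite /F => /andP[lej ltj].
  by rewrite (ltn_eqF ltj) (ltnW ltj).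
by rewrite (gtn_eqF lej) leqNgt lej.
Qed.

Lemma silly_prod_lift n (p : 'S_n.+1) (i : 'I_n.+2) a b :
  let g j := silly_weight p (inord j) in
  let g' (i j : nat) := if j == max_pos p :> nat then (if (max_pos p < i)%N then y else x) else g j in
  silly_prod (lift_perm i ord_max p) a b =
  (if i == n.+1 :> nat then 1 else b) *
  (\prod_(0 <= j < i) (a + g' i j) * \prod_(i.+1 <= j < n.+1) (b + g' i j)).
Proof.
move=> g g'; rewrite /silly_prod max_pos_lift big_mkcond (bigD1_ord i) //= eqxx /= mul1r.
pose F j := (if (bump i j <= i)%N then a else b) + (if j == i then 0 else g' i j).
transitivity (\prod_(0 <= j < n.+1) F j).
  rewrite big_mkord; apply: eq_bigr => j _.
  rewrite eq_sym neq_lift /F silly_weight_lift /g' /g inord_val.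
  by congr (_ + _); case: ifP => // _; rewrite -val_eqE.
rewrite (big_cat_nat (n := i)) ?leq_ord // mulrCA; congr (_ * _).
  apply: eq_big_nat => j /andP[_ ltji]; rewrite /F /bump [(i <= j)%N]leqNgt ltji /= add0n.
  by rewrite (ltnW ltji) (ltn_eqF ltji).
case: eqP => [->|/eqP neq_in].
  by rewrite !big_geq // mulr1.
have ltin : (i < n.+1)%N by have := ltn_ord i; lia.
rewrite /= big_ltn // {1}/F /bump leqnn /= add1n ltnn eqxx addr0; congr (_ * _).
apply: eq_big_nat => j /andP[ltij _]; rewrite /F /bump (ltnW ltij) add1n /=.
by rewrite ltnNge (ltnW ltij) /= (gtn_eqF ltij).
Qed.

Definition silly_catalytic n (a b : R) : R :=
  if n is n'.+1 then \sum_(p : 'S_n'.+1) s ^+ rmin p * silly_prod p a b else 0.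

Lemma silly_catalyticS n a b :
  (a - b) * silly_catalytic n.+2 a b = insertion x y y s false (silly_catalytic n.+1) a b.
Proof.
rewrite /= sum_lift_perm_max insertion_sum mulr_sumr; apply: eq_bigr => p _.
rewrite (eq_insertion _ _ _ _ _ _ _ (silly_prodE p)) /=.
rewrite -silly_insertion ?leq_ord //.
rewrite mulrCA; congr (_ * _); rewrite big_mkord mulr_sumr; apply: eq_bigr => i _.
rewrite rmin_lift silly_prod_lift exprD mulrAC mulrC; congr (_ * _).
by rewrite !mulrA; congr (_ * _ * _ * _); case: eqP; rewrite ?expr0 ?expr1.
Qed.

Lemma silly_catalytic1 a b : silly_catalytic 1 a b = s.
Proof.
rewrite -[RHS](perm_catalytic1 x y y s a b); apply: eq_bigr => p _.
by rewrite /silly_prod /perm_prod !big1 // => j; rewrite ?[max_pos p]ord1 ord1.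
Qed.

Lemma silly_catalytic_poly n a : exists q : {poly R}, forall b, silly_catalytic n a b = q.[b].
Proof.
case: n => [|n]; first by exists 0 => b; rewrite horner0.
exists (\sum_(p : 'S_n.+1) (s ^+ rmin p) *:
   \prod_(j : 'I_n.+1 | j != max_pos p)
     ((if (j <= max_pos p)%N then a%:P else 'X) + (silly_weight p j)%:P)) => b.
rewrite horner_sum; apply: eq_bigr => p _; rewrite hornerZ horner_prod; congr (_ * _).
by apply: eq_bigr => j _; rewrite hornerD hornerC; case: ifP; rewrite ?hornerC ?hornerX.
Qed.
End SillyCatalytic.

(** The maximum is not a silly ascent, so its missing factor is 1. Elsewhere the value one more has
    a unique position, to the left or to the right of [j]. *)
Lemma silly_prod1 (R : fieldType) (x y : R) n (p : 'S_n.+1) :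
  silly_prod (x - 1) (y - 1) p 1 1 = x ^+ p_silly p * y ^+ q_silly p.
Proof.
rewrite /p_silly /q_silly -!prod_indicator -!big_split /= /silly_prod big_mkcond.
apply: eq_bigr => j _; rewrite !inE if_same.
case: eqP => [->|_] /=.
  by rewrite /silly_ascent permKV ltnn /= mulr1.
rewrite /silly_weight; case Aj: (silly_ascent p j); last by rewrite addr0 /= mulr1.
have /andP[lt_k _] := Aj.
pose k := (p^-1)%g (Ordinal lt_k); have Ek : p k = (p j).+1 :> nat by rewrite permKV.
have E (P : pred 'I_n.+1) : [exists k', (p k' == (p j).+1 :> nat) && P k'] = P k.
  apply/existsP/idP => [[k' /andP[/eqP Ek' Pk']]|Pk]; last by exists k; rewrite Ek eqxx.
  by have -> : k = k' by apply: (@perm_inj _ p); apply: val_inj; rewrite /= Ek Ek'.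
rewrite !E /=; have neq_kj : k != j :> nat by apply/negP => /eqP/val_inj kj; move: Ek; rewrite kj; lia.
have -> : (j < k)%N = ~~ (k < j)%N by lia.
by case: ifP => _ /=; ring.
Qed.

Lemma silly_sum_catalytic (R : fieldType) (x y s : R) n : [pchar R] =i pred0 ->
  \sum_(p : 'S_n.+1) s ^+ rmin p * (x ^+ p_silly p * y ^+ q_silly p) =
  catalytic (x - 1) (y - 1) (y - 1) s false n.+1 1 1.
Proof.
move=> R0; rewrite -(catalytic_unique (A := silly_catalytic (x - 1) (y - 1) s)) //.
- by apply: eq_bigr => p _; rewrite silly_prod1.
- exact: silly_catalytic_poly.
- exact: silly_catalytic1.
- exact: silly_catalyticS.
Qed.

(** * Matchings as sequences of labelled closers *)

Section CodeInsertion.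
Variables (R : fieldType) (x y z s : R).

(* [u j] is [-1] when the label [j] is unused and [0] otherwise. *)
Lemma code_insertion (u : nat -> R) k q (a b : R) :
    (q <= k)%N -> u q = 0 -> u 0%N = 0 -> u k.+1 = -1 ->
  let F k i := (if i == 0%N then s else 1) *
    (\prod_(0 <= j < i) (a + u j) * \prod_(i.+1 <= j < k.+1) (b + u j)) in
  (a - b) * (\sum_(0 <= i < k.+1) step_weight x y z q i * F k i + \sum_(0 <= i < k.+2) F k.+1 i) =
  insertion (x - 1) (y - 1) (z - 1) s true
    (fun a b => \prod_(0 <= j < q) (a + u j) * \prod_(q.+1 <= j < k.+1) (b + u j)) a b.
Proof.
move=> leqk uq u0 uk F; pose A c := \prod_(0 <= j < q) (c + u j).
pose B c := \prod_(q.+1 <= j < k.+1) (c + u j).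
pose G i := \prod_(0 <= j < i) (a + u j) * \prod_(i.+1 <= j < k.+1) (b + u j).
have TA := removed_factor_telescope u a b (leq0n q).
have TB := removed_factor_telescope u a b (leqk : q.+1 <= k.+1)%N.
pose SA := \sum_(0 <= i < q) (\prod_(0 <= j < i) (a + u j)) * \prod_(i.+1 <= j < q) (b + u j).
pose SB := \sum_(q.+1 <= i < k.+1)
  (\prod_(q.+1 <= j < i) (a + u j)) * \prod_(i.+1 <= j < k.+1) (b + u j).
rewrite -/SA -/(A a) -/(A b) in TA; rewrite -/SB -/(B a) -/(B b) in TB.
rewrite /insertion /marked_insertion -!/(A _) -!/(B _).
have EAB c : \prod_(0 <= j < k.+1) (c + u j) = A c * (c * B c).
  rewrite (big_cat_nat (n := q)) //; last by lia.
  by rewrite /= [X in _ * X = _]big_ltn // uq addr0.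
have -> : \sum_(0 <= i < k.+1) step_weight x y z q i * F k i + \sum_(0 <= i < k.+2) F k.+1 i =
    \sum_(0 <= i < k.+1) (step_weight x y z q i + (b - 1)) * ((if i == 0%N then s else 1) * G i)
    + A a * (a * B a).
  rewrite [X in _ + X = _]big_nat_recr // addrA; congr (_ + _); last first.
    by rewrite /F (big_geq (leqnn _)) mul1r mulr1 EAB.
  rewrite -big_split /=; apply: eq_big_nat => i /andP[_ lti].
  by rewrite /F /G [\prod_(i.+1 <= j < k.+2) _](big_nat_recr k.+1) //= uk; ring.
have -> : \sum_(0 <= i < k.+1) (step_weight x y z q i + (b - 1)) * ((if i == 0%N then s else 1) * G i) =
    \sum_(0 <= i < k.+1) (step_weight x y z q i + (b - 1)) * G i
    + (s - 1) * (step_weight x y z q 0 + (b - 1)) * G 0%N.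
  rewrite big_ltn // [X in _ = X + _]big_ltn //=.
  rewrite [X in _ + X = _](eq_big_nat _ _ (F2 := fun i => (step_weight x y z q i + (b - 1)) * G i)).
    by ring.
  by move=> i /andP[i_gt0 _]; rewrite (gtn_eqF i_gt0) mul1r.
have -> : \sum_(0 <= i < k.+1) (step_weight x y z q i + (b - 1)) * G i =
    \sum_(0 <= i < q) (step_weight x y z q i + (b - 1)) * G i
    + ((z + (b - 1)) * (A a * B b)
    + \sum_(q.+1 <= i < k.+1) (step_weight x y z q i + (b - 1)) * G i).
  rewrite (big_cat_nat (n := q)) //=; last by lia.
  by rewrite [X in _ + X = _]big_ltn // /step_weight ltnn.
rewrite [X in _ * (X + _ + _ + _)](eq_big_nat _ _ (F2 := fun i => (x + (b - 1)) * b * B b *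
    ((\prod_(0 <= j < i) (a + u j)) * \prod_(i.+1 <= j < q) (b + u j)))); last first.
  move=> i /andP[_ ltiq]; rewrite /step_weight ltiq /G [X in _ * (_ * X) = _](big_cat_nat (n := q)) //; last by lia.
  by rewrite /= [X in _ * (_ * (_ * X)) = _]big_ltn // uq -/(B b); ring.
rewrite [X in _ * (_ + (_ + X) + _ + _)](eq_big_nat _ _ (F2 := fun i => (y + (b - 1)) * a * A a *
    ((\prod_(q.+1 <= j < i) (a + u j)) * \prod_(i.+1 <= j < k.+1) (b + u j)))); last first.
  move=> i /andP[ltqi _]; rewrite /step_weight ltnNge (ltnW ltqi) ltqi /G.
  rewrite [X in _ * (X * _) = _](big_cat_nat (n := q)) //; last by lia.
  by rewrite /= [X in _ * (_ * X * _) = _]big_ltn // uq -/(A a); ring.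
rewrite -!mulr_sumr.
rewrite -/SA -/SB.
transitivity ((x + (b - 1)) * b * B b * ((a - b) * SA) + (y + (b - 1)) * a * A a * ((a - b) * SB)
  + (a - b) * ((z + (b - 1)) * (A a * B b)) + (a - b) * (A a * (a * B a))
  + (a - b) * ((s - 1) * (step_weight x y z q 0 + (b - 1)) * G 0%N)); first by ring.
rewrite TA TB /G (big_geq (leqnn 0)) mul1r /step_weight.
case: (posnP q) => [q0|q_gt0].
  have A1 c : A c = 1 by rewrite /A q0 big_geq.
  have -> : \prod_(1 <= j < k.+1) (b + u j) = B b by rewrite /B q0.
  by rewrite q0 !A1 /=; ring.
(* The label 0 is in use, so its factor vanishes at 0, and the boundary value [f 0 b] drops out when
   the last label is positive. *)
have -> : A 0 = 0 by rewrite /A big_ltn // u0 addr0 mul0r.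
have -> : \prod_(1 <= j < k.+1) (b + u j) = A b * B b.
  rewrite (big_cat_nat (n := q)) //; last by lia.
  rewrite /= [X in _ * X = _]big_ltn // uq /A [in RHS]big_ltn // u0 -/(B b).
  by ring.
by ring.
Qed.
End CodeInsertion.

(* A code lists the arcs by increasing closer, each as the pair of the index of its
   closer run (its block) and the index of its opener run (its label). *)
Definition next_letters (c : seq (nat * nat)) : seq (nat * nat) :=
  if c is v :: c' then
    let k := (last v c').1 in
    [seq (k, i) | i <- iota 0 k.+1] ++ [seq (k.+1, i) | i <- iota 0 k.+2]
  else [:: (0, 0)]%N.

Fixpoint codes n : seq (seq (nat * nat)) :=
  if n is n'.+1 then flatten [seq [seq rcons c v | v <- next_letters c] | c <- codes n']
  else [:: [::]].

Local Notation block c i := (nth (0, 0)%N c i).1.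
Local Notation label c i := (nth (0, 0)%N c i).2.

(** The last clause expresses that an arc opens before the run in which it closes. *)
Definition valid_code (c : seq (nat * nat)) : Prop :=
  [/\ block c 0 = 0%N,
      forall i, (i.+1 < size c)%N -> block c i.+1 = block c i \/ block c i.+1 = (block c i).+1
    & forall i, (i < size c)%N -> (label c i <= block c i)%N].

Lemma next_lettersP c v : valid_code c ->
  reflect (valid_code (rcons c v)) (v \in next_letters c).
Proof.
move=> Vc; case: c Vc => [|w c] Vc.
  rewrite inE; apply: (iffP eqP) => [->|[/= b0 _ /(_ 0%N isT) /=]]; first by split => // -[].
  by case: v b0 => k l /= ->; rewrite leqn0 => /eqP->.
have [b0 step lb] := Vc; set k := (last w c).1.
have Ek : block (w :: c) (size c) = k by rewrite -[size c]/(size (w :: c)).-1 nth_last.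
have Evalid : valid_code (rcons (w :: c) v) <-> (v.1 = k \/ v.1 = k.+1) /\ (v.2 <= v.1)%N.
  split=> [[_ step' lb']|[stepv lbv]].
    split.
      have := step' (size c); rewrite size_rcons => /(_ (ltnSn _)).
      by rewrite !nth_rcons [size (_ :: _)]/= ltnn eqxx ltnSn Ek.
    by have := lb' (size c).+1; rewrite size_rcons nth_rcons [size (_ :: _)]/= ltnn eqxx => /(_ (ltnSn _)).
  split=> // i; rewrite size_rcons !nth_rcons [size (_ :: _)]/=; last first.
    by rewrite ltnS leq_eqVlt => /predU1P[->|lti]; rewrite ?ltnn ?eqxx // lti; apply: lb.
  rewrite ltnS => lti; have {lti} : (i <= size c)%N := lti.
  rewrite leq_eqVlt => /predU1P[->|lti]; first by rewrite ltnn eqxx ltnSn Ek.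
  by rewrite !ltnS lti (ltnW lti); apply: step.
apply: (iffP idP).
  move=> vin; apply/Evalid; move: vin; rewrite mem_cat => /orP[] /mapP[i].
    by rewrite mem_iota /= => lti -> /=; split; [left|lia].
  by rewrite mem_iota /= => lti -> /=; split; [right|lia].
case/Evalid=> -[] Ev le; rewrite mem_cat; apply/orP; [left|right]; apply/mapP; exists v.2.
- by rewrite mem_iota ltnS; move: le; rewrite Ev.
- by move: (surjective_pairing v); rewrite {1}Ev.
- by rewrite mem_iota ltnS; move: le; rewrite Ev.
- by move: (surjective_pairing v); rewrite {1}Ev.
Qed.

Lemma codesP n c : reflect (size c = n /\ valid_code c) (c \in codes n).
Proof.
elim: n c => [|n IHn] c /=.
  rewrite inE; apply: (iffP eqP) => [->|[/size0nil -> //]].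
  by split => //; split.
apply: (iffP flatten_mapP) => [[c' /IHn[sz Vc'] /mapP[v /(next_lettersP _ Vc') Vv ->]]|[]].
  by rewrite size_rcons sz.
case: (lastP c) => // c' v; rewrite size_rcons => -[sz] [b0 step lb].
have Vc' : valid_code c'.
  have E i : (i < size c')%N -> nth (0, 0)%N (rcons c' v) i = nth (0, 0)%N c' i.
    by move=> lti; rewrite nth_rcons lti.
  split=> [|i lti|i lti].
  - by case: c' E b0 {step lb sz} => // w c' E; rewrite E.
  - by rewrite -!E ?(ltnW lti) //; apply: step; rewrite size_rcons ltnW.
  - by rewrite -!E //; apply: lb; rewrite size_rcons ltnW.
exists c'; first by apply/IHn.
by apply: map_f; apply/next_lettersP => //; split.
Qed.

Lemma next_letters_uniq c : uniq (next_letters c).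
Proof.
case: c => // w c; rewrite /next_letters cat_uniq !map_inj_uniq ?iota_uniq ?andbT.
- by apply/hasP => -[_ /mapP[i _ ->] /mapP[j _ [E _]]]; lia.
- by move=> i j [].
- by move=> i j [].
Qed.

Lemma codes_uniq n : uniq (codes n).
Proof.
elim: n => //= n IHn; apply: allpairs_uniq_dep => // [c _|[c v] [c' v'] _ _ /= /rcons_inj [-> ->] //].
exact: next_letters_uniq.
Qed.

Definition code_labels (c : seq (nat * nat)) : seq nat := [seq v.2 | v <- c].

(** Each closer run is preceded by a run of openers carrying its index, so every index up to the
    last one must occur as a label. *)
Definition surjective_code (c : seq (nat * nat)) : bool :=
  all (mem (code_labels c)) (iota 0 (last (0, 0)%N c).1.+1).

Lemma block_mono c i j : valid_code c -> (i <= j < size c)%N -> (block c i <= block c j)%N.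
Proof.
case=> _ step _; elim: j => [|j IHj] /andP[]; first by rewrite leqn0 => /eqP->.
rewrite leq_eqVlt => /predU1P[-> //|leij ltj]; apply: leq_trans (IHj _) _.
  by rewrite -ltnS leij ltnW.
by case: (step j ltj) => ->.
Qed.

(** * The catalytic sum over codes *)

Section CodeCatalytic.
Variables (R : fieldType) (x y z s : R).

Definition code_weight (c : seq (nat * nat)) : R :=
  \prod_(i < size c) ((if label c i == 0%N then s else 1) *
    (if (0 < i)%N && (block c i == block c i.-1) then
       step_weight x y z (label c i.-1) (label c i) else 1)).

Definition unused c j : R := if j \in code_labels c then 0 else -1.

(** The last label has no factor, being in use. At [a = b = 1] the product is the indicator that all
    labels are used. *)
Definition code_prod (c : seq (nat * nat)) (a b : R) : R :=
  let v := last (0, 0)%N c in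
  \prod_(0 <= j < v.2) (a + unused c j) * \prod_(v.2.+1 <= j < v.1.+1) (b + unused c j).

Definition code_catalytic n (a b : R) : R :=
  if n is n'.+1 then \sum_(c <- codes n'.+1) code_weight c * code_prod c a b else 0.

Lemma code_weight_rcons w c v :
  code_weight (rcons (w :: c) v) = code_weight (w :: c) *
   ((if v.2 == 0%N then s else 1) *
    (if v.1 == (last w c).1 then step_weight x y z (last w c).2 v.2 else 1)).
Proof.
rewrite /code_weight size_rcons big_ord_recr; congr (_ * _).
  apply: eq_bigr => i _ /=; rewrite -rcons_cons !nth_rcons ltn_ord.
  by have -> : (i.-1 < size (w :: c))%N by have := ltn_ord i; rewrite /=; lia.
rewrite !nth_rcons ltnn eqxx [size (_ :: _)]/= ltnSn -[size c]/(size (w :: c)).-1.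
by rewrite nth_last.
Qed.

Lemma code_prod_rcons c v a b : code_prod (rcons c v) a b =
  \prod_(0 <= j < v.2) (a + unused c j) * \prod_(v.2.+1 <= j < v.1.+1) (b + unused c j).
Proof.
have E j : j != v.2 -> unused (rcons c v) j = unused c j.
  by move=> neq; rewrite /unused /code_labels map_rcons mem_rcons inE (negbTE neq).
rewrite /code_prod last_rcons; congr (_ * _); apply: eq_big_nat => j /andP[lej ltj].
  by rewrite E // ltn_eqF.
by rewrite E // gtn_eqF.
Qed.

Lemma code_catalyticS n a b :
  (a - b) * code_catalytic n.+2 a b =
  insertion (x - 1) (y - 1) (z - 1) s true (code_catalytic n.+1) a b.
Proof.
rewrite /code_catalytic (_ : codes n.+2 = [seq rcons c v | c <- codes n.+1, v <- next_letters c]) //.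
rewrite big_allpairs_dep insertion_sum mulr_sumr.
apply: eq_big_seq => c /codesP[sz Vc]; case: c sz Vc => // w c _ Vc; have [b0 step lb] := Vc.
set cw := w :: c; pose q := (last w c).2; pose k := (last w c).1.
have Elast : last w c = nth (0, 0)%N cw (size c) by rewrite -[size c]/(size cw).-1 nth_last.
have leqk : (q <= k)%N by rewrite /q /k Elast; apply: (lb _ (ltnSn _)).
have kmono i : (i < size cw)%N -> (block cw i <= k)%N.
  by move=> lti; rewrite /k Elast; apply: block_mono; rewrite // -ltnS lti leqnn.
have uq : unused cw q = 0.
  rewrite /unused /code_labels /q; have -> // : (last w c).2 \in [seq v.2 | v <- cw].
  by apply: map_f; apply: mem_last.
have u0 : unused cw 0 = 0.
  rewrite /unused; have -> // : 0%N \in code_labels cw.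
  apply/mapP; exists (nth (0, 0)%N cw 0); first by rewrite mem_nth.
  by apply/esym/eqP; rewrite -leqn0 -[leqRHS]b0 lb.
have uk : unused cw k.+1 = -1.
  rewrite /unused; case: mapP => // -[v] /(nthP (0, 0)%N)[i lti <-] E.
  by have := leq_trans (lb i lti) (kmono i lti); rewrite -E ltnn.
rewrite -(code_insertion x y z s _ _ leqk uq u0 uk) mulrCA; congr (_ * _).
rewrite [next_letters _]/next_letters big_cat !big_map mulrDr -/k.
rewrite !mulr_sumr /index_iota !subn0; congr (_ + _); apply: eq_bigr => i _.
  rewrite code_weight_rcons code_prod_rcons [(_, _).1]/= [(_, _).2]/= eqxx.
  by rewrite -/q; ring.
rewrite code_weight_rcons code_prod_rcons [(_, _).1]/= [(_, _).2]/= (gtn_eqF (ltnSn _)).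
by ring.
Qed.

Lemma code_catalytic1 a b : code_catalytic 1 a b = s.
Proof.
rewrite /code_catalytic /= big_seq1 /code_weight /code_prod /= big_ord1 /= !big_geq //.
by rewrite !mulr1.
Qed.

Lemma code_catalytic_poly n a : exists q : {poly R}, forall b, code_catalytic n a b = q.[b].
Proof.
case: n => [|n]; first by exists 0 => b; rewrite horner0.
exists (\sum_(c <- codes n.+1)
  (code_weight c * \prod_(0 <= j < (last (0, 0)%N c).2) (a + unused c j)) *:
  \prod_((last (0, 0)%N c).2.+1 <= j < (last (0, 0)%N c).1.+1) ('X + (unused c j)%:P)) => b.
rewrite horner_sum; apply: eq_bigr => c _; rewrite hornerZ horner_prod -mulrA.
by congr (_ * (_ * _)); apply: eq_bigr => j _; rewrite hornerD hornerC hornerX.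
Qed.

Lemma code_prod1 n c : c \in codes n.+1 -> code_prod c 1 1 = (surjective_code c)%:R.
Proof.
case/codesP; case: c => // w c _ [_ _ lb]; rewrite /code_prod /surjective_code [last _ _]/=.
set cw := w :: c; set q := (last w c).2; set k := (last w c).1.
have Elast : last w c = nth (0, 0)%N cw (size c) by rewrite -[size c]/(size cw).-1 nth_last.
have leqk : (q <= k)%N by rewrite /q /k Elast; apply: (lb _ (ltnSn _)).
have uq : q \in code_labels cw by apply: map_f; apply: mem_last.
have E lo hi : \prod_(lo <= j < hi) (1 + unused cw j) =
    (all (mem (code_labels cw)) (index_iota lo hi))%:R.
  elim: (index_iota lo hi) => [|j r IHr]; first by rewrite big_nil.
  rewrite big_cons IHr /= /unused; case: ifP => _; first by rewrite addr0 mul1r.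
  by rewrite subrr mul0r.
rewrite !E -natrM mulnb -all_cat; congr (nat_of_bool _)%:R.
have -> : iota 0 k.+1 = index_iota 0 q ++ q :: index_iota q.+1 k.+1.
  rewrite /index_iota subn0 subSS -[q :: _]/(iota q (k - q).+1).
  by rewrite -[in iota q _](add0n q) -iotaD; congr iota; lia.
by rewrite !all_cat /= uq.
Qed.
End CodeCatalytic.

Lemma code_sum_catalytic (R : fieldType) (x y z s : R) n : [pchar R] =i pred0 ->
  \sum_(c <- codes n.+1 | surjective_code c) code_weight x y z s c =
  catalytic (x - 1) (y - 1) (z - 1) s true n.+1 1 1.
Proof.
move=> R0; rewrite -(catalytic_unique (A := code_catalytic x y z s)) //.
- rewrite big_mkcond; apply: eq_big_seq => c /code_prod1 ->.
  by case: ifP; rewrite ?mulr1 ?mulr0.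
- exact: code_catalytic_poly.
- exact: code_catalytic1.
- exact: code_catalyticS.
Qed.

(** * Arc systems: matchings as pairs of opener and closer functions *)

Section ArcSystems.
Local Open Scope nat_scope.

Local Notation "#{ i < n | P }" := (count (fun i => P) (iota 0 n))
  (at level 0, i name, n at level 60, format "#{ i < n | P }").

Lemma eq_count_iota n (P Q : pred nat) : (forall i, i < n -> P i = Q i) ->
  #{i < n | P i} = #{i < n | Q i}.
Proof. by move=> E; apply: eq_in_count => i; rewrite mem_iota => /E. Qed.

Lemma leq_count_iota n (P Q : pred nat) : (forall i, i < n -> P i -> Q i) ->
  #{i < n | P i} <= #{i < n | Q i}.
Proof.
move=> PQ; have: all (fun i => P i ==> Q i) (iota 0 n).
  by apply/allP => i; rewrite mem_iota => /PQ /implyP.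
elim: (iota 0 n) => //= i r IHr /andP[/implyP PQi /IHr].
by case: (P i) PQi => [->|_] //; apply: leq_add.
Qed.

Lemma ltn_count_iota n (P Q : pred nat) j : (forall i, i < n -> P i -> Q i) ->
  j < n -> Q j -> ~~ P j -> #{i < n | P i} < #{i < n | Q i}.
Proof.
move=> PQ ltj Qj nPj.
have := count_predUI P (pred1 j) (iota 0 n); rewrite count_uniq_mem ?iota_uniq // mem_iota ltj.
have -> : count (predI P (pred1 j)) (iota 0 n) = 0.
  rewrite -[RHS](count_pred0 (iota 0 n)); apply: eq_count => i /=.
  by case: eqP => [->|_]; rewrite ?andbF ?(negbTE nPj).
rewrite addn0 addn1 => <-; apply: leq_count_iota => i lti /= /orP[/PQ->//|/eqP-> //].
Qed.

Lemma count_iota_ltn n m : m <= n -> #{i < n | i < m} = m.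
Proof.
move=> lemn; rewrite -{1}(subnKC lemn) iotaD count_cat add0n.
have -> : count (fun i => i < m) (iota 0 m) = m.
  by rewrite -[RHS](size_iota 0 m); apply/eqP; rewrite -all_count; apply/allP => i; rewrite mem_iota.
rewrite -[RHS]addn0; congr (_ + _); apply/eqP; rewrite -leqn0 leqNgt -has_count.
by apply/hasPn => i; rewrite mem_iota -leqNgt => /andP[].
Qed.

(** For increasing [c], the indices with value below [v] form an initial segment. *)
Lemma ltn_increasing_count n (c : nat -> nat) v i :
  (forall i j, i < j < n -> c i < c j) -> i < n -> (c i < v) = (i < #{j < n | c j < v}).
Proof.
move=> c_incr lti; have c_mono i' j : i' <= j < n -> c i' <= c j.
  case/andP; rewrite leq_eqVlt => /predU1P[-> //|lt_ij ltj].
  by rewrite ltnW // c_incr ?lt_ij.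
apply/idP/idP => [ltc|].
  rewrite -[X in X <= _](count_iota_ltn lti); apply: leq_count_iota => j ltj leji.
  by apply: leq_ltn_trans ltc; rewrite c_mono // -ltnS leji.
apply: contraTT; rewrite -!leqNgt => lev; rewrite -[X in _ <= X](count_iota_ltn (ltnW lti)).
apply: leq_count_iota => j ltj; apply: contraTT; rewrite -!leqNgt => leij.
by apply: leq_trans lev _; rewrite c_mono // leij.
Qed.

Definition arc_system n (o c : nat -> nat) : Prop :=
  [/\ forall i j, i < j < n -> c i < c j,
      forall i, i < n -> o i < c i,
      perm_eq (map o (iota 0 n) ++ map c (iota 0 n)) (iota 0 (2 * n))
    & forall i j, i < n -> j < n -> o i = (o j).+1 -> ~~ (c i < c j)].

(** Each closer not immediately followed by the next one ends a run, so this is the index of the run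
    of closer [i]. *)
Definition block_of (c : nat -> nat) i := #{i' < i | c i'.+1 != (c i').+1}.
(* The run of an opener has the index of the first closer run after it. *)
Definition label_of n (o c : nat -> nat) j := block_of c #{i < n | c i < o j}.

(** Closer [i] is preceded by the [i] earlier closers and by the openers whose label is at most its
    block. *)
Definition closer_pos n (k l : nat -> nat) i := i + #{j < n | l j <= k i}.
(* Inside a run of openers the absence of left nestings forces the order of the
   closers. *)
Definition opener_pos n (k l : nat -> nat) j :=
  #{i < n | k i < l j} + #{i < n | (l i < l j) || (l i == l j) && (i < j)}.

(** The functional form of a valid surjective code; the blocks attained are all the numbers up to
    the last one. *)
Definition code_fun n (k l : nat -> nat) : Prop :=
  [/\ k 0 = 0, forall i, i.+1 < n -> k i.+1 = k i \/ k i.+1 = (k i).+1,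
      forall i, i < n -> l i <= k i
    & forall i, i < n -> exists2 j, j < n & l j = k i].

Lemma block_ofS c i : block_of c i.+1 = block_of c i + (c i.+1 != (c i).+1).
Proof. by rewrite /block_of -[in iota 0 i.+1]addn1 iotaD count_cat /= addn0 add0n. Qed.

Lemma block_of_mono c i j : i <= j -> block_of c i <= block_of c j.
Proof. by move=> leij; rewrite /block_of -(subnKC leij) iotaD count_cat leq_addr. Qed.

(** * The code of an arc system determines it *)

Section Encoding.
Variables (n : nat) (o c : nat -> nat).
Hypothesis oc : arc_system n o c.

Let c_incr i j : i < j < n -> c i < c j. Proof. by case: oc => H _ _ _; apply: H. Qed.
Let ltoc i : i < n -> o i < c i. Proof. by case: oc => _ H _ _; apply: H. Qed.
Let perm_oc : perm_eq (map o (iota 0 n) ++ map c (iota 0 n)) (iota 0 (2 * n)).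
Proof. by case: oc. Qed.
Let no_ln i j : i < n -> j < n -> o i = (o j).+1 -> ~~ (c i < c j).
Proof. by case: oc => _ _ _ H; apply: H. Qed.

Let uniq_oc : uniq (map o (iota 0 n) ++ map c (iota 0 n)).
Proof. by rewrite (perm_uniq perm_oc) iota_uniq. Qed.

Lemma opener_neq_closer i j : i < n -> j < n -> o i != c j.
Proof.
move=> lti ltj; apply/eqP => E; move: uniq_oc; rewrite cat_uniq => /and3P[_ /hasP[]].
by exists (c j); rewrite ?map_f ?mem_iota // -E map_f ?mem_iota.
Qed.

Let o_inj i j : i < n -> j < n -> o i = o j -> i = j.
Proof.
move=> lti ltj E; move: uniq_oc; rewrite cat_uniq => /andP[U _].
have := nth_uniq 0 _ _ U; rewrite size_map size_iota => /(_ i j lti ltj).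
by rewrite !(nth_map 0) ?size_iota // !nth_iota // !add0n E eqxx => /esym/eqP.
Qed.

Let oc_cover v : v < 2 * n -> (exists2 i, i < n & o i = v) \/ (exists2 i, i < n & c i = v).
Proof.
have := perm_mem perm_oc v; rewrite mem_iota add0n /= mem_cat => /[swap] -> /orP[] /mapP[i].
  by rewrite mem_iota => lti ->; left; exists i.
by rewrite mem_iota => lti ->; right; exists i.
Qed.

Let c_lt_inv i j : i < n -> j < n -> c i < c j -> i < j.
Proof.
move=> lti ltj; case: (ltngtP i j) => [//|ltji|->]; last by rewrite ltnn.
by rewrite ltnNge ltnW // c_incr // ltji.
Qed.

Let cn i : i < n -> c i < 2 * n.
Proof.
move=> lti; have := perm_mem perm_oc (c i); rewrite mem_iota add0n /= => <-.
by rewrite mem_cat map_f ?orbT // mem_iota.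
Qed.

Let k := block_of c.
Let l := label_of n o c.

Lemma closed_runs_leq j : j < n -> #{i < n | c i < o j} <= j.
Proof.
move=> ltj; rewrite leqNgt -ltn_increasing_count // -leqNgt ltnW //.
exact: ltoc.
Qed.

(** If [N > 0] closers lie before [o j], this opener separates the closers [N.-1] and [N], so the
    block rises exactly there. *)
Lemma closer_before i j : i < n -> j < n -> (c i < o j) = (k i < l j).
Proof.
move=> lti ltj; rewrite (ltn_increasing_count _ c_incr lti) /l /label_of.
set N := #{_ < _ | _}; have leNj : N <= j by apply: closed_runs_leq.
case: ltnP => [ltiN|leNi]; last by rewrite ltnNge block_of_mono.
apply/esym; have N_gt0 : 0 < N by apply: leq_ltn_trans ltiN.
have ltN1 : N.-1 < n by apply: leq_ltn_trans ltj; lia.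
have ltNn : N < n by apply: leq_ltn_trans ltj.
have ltc : c N.-1 < o j by rewrite (ltn_increasing_count _ c_incr ltN1) -/N; lia.
have lec : o j < c N.
  rewrite ltn_neqAle opener_neq_closer //= leqNgt (ltn_increasing_count _ c_incr ltNn) -/N.
  by rewrite ltnn.
apply: leq_ltn_trans (block_of_mono c (_ : i <= N.-1)) _; first by lia.
rewrite -[X in _ < block_of c X](prednK N_gt0) block_ofS prednK //.
have -> : c N != (c N.-1).+1 by lia.
by rewrite addn1.
Qed.

Lemma label_mono i j : i < n -> j < n -> o i <= o j -> l i <= l j.
Proof.
move=> lti ltj le_o; apply: block_of_mono; apply: leq_count_iota => i' _ /leq_trans; exact.
Qed.

(** Adjacent openers close in the order in which they open, by the absence of left nestings. The
    induction on the distance moves to the position before [o j], which is an opener, since a closer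
    there would separate the labels. *)
Lemma opener_before_same d i j : i < n -> j < n -> l i = l j -> o j = o i + d.+1 -> i < j.
Proof.
elim: d j => [|d IHd] j lti ltj El Eo.
  have := no_ln ltj lti; rewrite Eo addn1 => /(_ erefl); rewrite -leqNgt leq_eqVlt => /predU1P[E|].
    have := c_incr (i := j) (j := i); have := c_incr (i := i) (j := j).
    by move: E Eo; case: (ltngtP i j) => // [|->]; lia.
  exact: c_lt_inv.
have [|[j' ltj' Ej']|[j' ltj' Ej']] := @oc_cover (o j).-1.
- by have := cn ltj; have := ltoc ltj; lia.
- have E1 : o j = (o j').+1 by lia.
  have := no_ln ltj ltj' E1; rewrite -leqNgt leq_eqVlt => /predU1P[E|/c_lt_inv lt_j'j].
    have := c_incr (i := j') (j := j); have := c_incr (i := j) (j := j').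
    by move: E E1; case: (ltngtP j' j) => // [||->]; lia.
  apply: ltn_trans (lt_j'j ltj' ltj); apply: IHd => //; last by lia.
  apply/eqP; rewrite eqn_leq label_mono //=; last by lia.
  by rewrite El label_mono //; lia.
- have : c j' < o j by lia.
  by rewrite closer_before // -El -closer_before // Ej'; lia.
Qed.

Lemma opener_before i j : i < n -> j < n ->
  (o i < o j) = (l i < l j) || (l i == l j) && (i < j).
Proof.
move=> lti ltj; case: (ltngtP (l i) (l j)) => [ltl|ltl|El] /=.
- by rewrite ltnNge; apply: contraTN ltl => /(label_mono ltj lti); rewrite -leqNgt.
- by apply: contraTF ltl => /ltnW/(label_mono lti ltj); rewrite -leqNgt.
apply/idP/idP => [lto|ltij].
  by apply: (@opener_before_same (o j - o i).-1) => //; lia.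
rewrite ltn_neqAle; apply/andP; split; first by apply/eqP => /(o_inj lti ltj); lia.
rewrite leqNgt; apply/negP => lto.
have := @opener_before_same (o i - o j).-1 j i ltj lti (esym El); lia.
Qed.

(** A position equals the number of openers and closers that lie before it. *)
Lemma closer_posE i : i < n -> closer_pos n k l i = c i.
Proof.
move=> lti; rewrite /closer_pos.
have -> : #{j < n | l j <= k i} = #{j < n | o j < c i}.
  apply: eq_count_iota => j ltj; rewrite leqNgt -closer_before // -leqNgt.
  by rewrite leq_eqVlt (negbTE (opener_neq_closer ltj lti)).
have {1}-> : i = #{j < n | c j < c i}.
  rewrite -[LHS](count_iota_ltn (ltnW lti)); apply: eq_count_iota => j ltj.
  apply/idP/idP => [ltji|]; [by rewrite c_incr ?ltji | exact: c_lt_inv].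
rewrite addnC -[RHS](@count_iota_ltn (2 * n)); last exact/ltnW/cn.
by rewrite -(seq.permP perm_oc) count_cat !count_map.
Qed.

Lemma opener_posE j : j < n -> opener_pos n k l j = o j.
Proof.
move=> ltj; rewrite /opener_pos.
have -> : #{i < n | k i < l j} = #{i < n | c i < o j}.
  by apply: eq_count_iota => i lti; rewrite closer_before.
have -> : #{i < n | (l i < l j) || (l i == l j) && (i < j)} = #{i < n | o i < o j}.
  by apply: eq_count_iota => i lti; rewrite opener_before.
rewrite addnC -[RHS](@count_iota_ltn (2 * n)).
  by rewrite -(seq.permP perm_oc) count_cat !count_map.
by have := cn ltj; have := ltoc ltj; lia.
Qed.

Lemma encoding_code_fun : code_fun n k l.
Proof.
split=> [//|i _|i lti|i lti].
- by rewrite /k block_ofS; case: eqP; [left|right]; lia.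
- exact/block_of_mono/closed_runs_leq.
(* The first closer [i0] of the run of [i] is immediately preceded by an opener, and the label of
   that opener is the block sought. *)
have ex : exists i0, (k i0 == k i) && (i0 <= i) by exists i; rewrite eqxx leqnn.
case: (ex_minnP ex) => i0 /andP[/eqP <- lei0i] min_i0.
have lti0 : i0 < n by apply: leq_ltn_trans lti.
have lt_oc := ltoc lti0; have lt_cn := cn lti0.
have [|[j ltj Ej]|[j ltj Ej]] := @oc_cover (c i0).-1; first by lia.
- exists j => //; apply/eqP; rewrite eqn_leq leqNgt -closer_before // -leqNgt Ej leq_pred /=.
  case: (posnP i0) => [->//|i0_gt0]; have lti1 : i0.-1 < n by lia.
  rewrite -[X in k X](prednK i0_gt0) /k block_ofS -/k.
  suff : k i0.-1 < l j by case: (_ != _); lia.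
  rewrite -closer_before // ltn_neqAle eq_sym opener_neq_closer //= Ej.
  by have := @c_incr i0.-1 i0; lia.
- have ltji0 : j < i0 by apply: c_lt_inv => //; lia.
  have Ei0 : i0 = j.+1.
    by case: (ltngtP i0 j.+1) => // [|lt1]; [lia|have := @c_incr j j.+1; have := @c_incr j.+1 i0; lia].
  have := min_i0 j; rewrite [k i0]/k {1}Ei0 block_ofS -Ei0 -/k.
  have -> : (c i0 != (c j).+1) = false by apply/negbTE/negPn/eqP; lia.
  by rewrite addn0 eqxx; lia.
Qed.

(** With equal labels, [j] and [j.+1] are neighbours in the lexicographic order of label and index,
    so no position lies between their openers. Thus plateaus of labels correspond to [LRcr]. *)
Lemma consecutive_openers j : j.+1 < n -> ((o j).+1 == o j.+1) = (l j == l j.+1).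
Proof.
move=> ltj1; have ltj := ltnW ltj1; apply/eqP/eqP => [Eo|El].
  apply/eqP; rewrite eqn_leq label_mono -?Eo //= leqNgt; apply/negP => ltl.
  have lt_N := leq_ltn_trans (closed_runs_leq ltj) ltj.
  have := closer_before lt_N ltj1; rewrite [k _]/(l j) ltl -Eo ltnS leq_eqVlt.
  by rewrite eq_sym (negbTE (opener_neq_closer _ _)) // closer_before // [k _]/(l j) ltnn.
have lt_o : o j < o j.+1 by rewrite opener_before // El eqxx ltnSn orbT.
have [|[j' ltj' Ej']|[i lti Ei]] := @oc_cover (o j.+1).-1.
- by have := ltoc ltj1; have := cn ltj1; lia.
- case: (ltngtP (o j) (o j')) => [lt_o'|lt_o'|E]; [|lia|lia].
  have lt_o2 : o j' < o j.+1 by lia.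
  have l1 := label_mono ltj ltj' (ltnW lt_o'); have l2 := label_mono ltj' ltj1 (ltnW lt_o2).
  by move: lt_o' lt_o2; rewrite !opener_before //; lia.
- have : c i < o j.+1 by lia.
  by rewrite closer_before // -El -closer_before //; lia.
Qed.
End Encoding.

(** * The arc system of a code *)

Section Decoding.
Variables (n : nat) (k l : nat -> nat).
Hypothesis kl : code_fun n k l.

Let k0 : k 0 = 0. Proof. by case: kl. Qed.
Let k_step i : i.+1 < n -> k i.+1 = k i \/ k i.+1 = (k i).+1.
Proof. by case: kl => _ H _ _; apply: H. Qed.
Let lk i : i < n -> l i <= k i. Proof. by case: kl => _ _ H _; apply: H. Qed.
Let l_surj i : i < n -> exists2 j, j < n & l j = k i.
Proof. by case: kl => _ _ _ H; apply: H. Qed.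

Let c := closer_pos n k l.
Let o := opener_pos n k l.

Let k_mono i j : i <= j -> j < n -> k i <= k j.
Proof.
elim: j => [|j IHj]; first by rewrite leqn0 => /eqP->.
rewrite leq_eqVlt => /predU1P[-> //|leij] ltj; apply: leq_trans (IHj _ (ltnW ltj)) _ => //.
by case: (k_step ltj) => ->.
Qed.

(** Blocks start at 0 and rise by at most one at a time, so they skip no value. *)
Lemma code_fun_val v j : j < n -> v <= k j -> exists2 i, i <= j & k i = v.
Proof.
elim: j => [|j IHj] ltj lev; first by exists 0 => //; move: lev; rewrite k0; case: (v).
have [le|lt] := leqP v (k j); first by have [i lei <-] := IHj (ltnW ltj) le; exists i => //; apply: ltnW.
by exists j.+1 => //; case: (k_step ltj) lev; lia.
Qed.

Let run_leq i j : i < n -> j < n -> k i < l j -> i < j.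
Proof.
move=> lti ltj; have := lk ltj; case: (leqP j i) => // leji.
by have := k_mono leji lti; lia.
Qed.

Let closed_count j : j < n -> #{i < n | k i < l j} <= j.
Proof.
move=> ltj; rewrite -[X in _ <= X](count_iota_ltn (ltnW ltj)).
by apply: leq_count_iota => i lti; apply: run_leq.
Qed.

Let oc_lt i j : i < n -> j < n -> l j <= k i -> o j < c i.
Proof.
move=> lti ltj le; rewrite /o /c /opener_pos /closer_pos -addnS leq_add //.
  rewrite -[X in _ <= X](count_iota_ltn (ltnW lti)); apply: leq_count_iota => i' lti' lt.
  by rewrite ltnNge; apply/negP => lei; have := k_mono lei lti'; lia.
apply: (@ltn_count_iota _ _ _ j) => //=; last by rewrite !ltnn andbF.
by move=> j' _; lia.
Qed.

Let co_lt i j : i < n -> j < n -> k i < l j -> c i < o j.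
Proof.
move=> lti ltj lt; rewrite /o /c /opener_pos /closer_pos -addSn leq_add //.
  rewrite -[X in X <= _](count_iota_ltn lti); apply: leq_count_iota => i' lti' lei.
  by apply: leq_ltn_trans lt; apply: k_mono.
by apply: leq_count_iota => j' _ le; rewrite (leq_ltn_trans le lt).
Qed.

Let c_incr i j : i < j < n -> c i < c j.
Proof.
case/andP => ltij ltj; rewrite /c /closer_pos -addSn leq_add //.
by apply: leq_count_iota => j' _ /leq_trans; apply; apply: k_mono => //; apply: ltnW.
Qed.

Let o_lt i j : i < n -> j < n -> (l i < l j) || (l i == l j) && (i < j) -> o i < o j.
Proof.
move=> lti ltj lex; rewrite /o /opener_pos -addnS leq_add //.
  by apply: leq_count_iota => i' _ lt; apply: leq_trans lt _; lia.
apply: (@ltn_count_iota _ _ _ i) => //=; last by rewrite !ltnn andbF.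
by move=> j' _; lia.
Qed.

Let o_inj i j : i < n -> j < n -> o i = o j -> i = j.
Proof.
move=> lti ltj E; have := o_lt lti ltj; have := o_lt ltj lti.
by rewrite E ltnn; lia.
Qed.

Let oc_neq i j : i < n -> j < n -> o i != c j.
Proof.
move=> lti ltj; case: (leqP (l i) (k j)) => [/(oc_lt ltj lti)|/(co_lt ltj lti)]; lia.
Qed.

Let c_inj i j : i < n -> j < n -> c i = c j -> i = j.
Proof.
move=> lti ltj E; case: (ltngtP i j) => // lt.
  by have := @c_incr i j; rewrite E ltnn lt ltj => /(_ isT).
by have := @c_incr j i; rewrite E ltnn lt lti => /(_ isT).
Qed.

Lemma decoding_closer_before i j : i < n -> j < n -> (c i < o j) = (k i < l j).
Proof.
move=> lti ltj; apply/idP/idP => [|/(co_lt lti ltj)//].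
by apply: contraTT; rewrite -!leqNgt => /(oc_lt lti ltj)/ltnW.
Qed.

(** The prescribed positions are distinct and smaller than [2 * n]; being [2 * n] in number, they
    fill the ground set. *)
Lemma decoding_arc_system : arc_system n o c.
Proof.
have lt_oc i : i < n -> o i < c i by move=> lti; apply: oc_lt => //; apply: lk.
have lt_c2 i : i < n -> c i < 2 * n.
  move=> lti; rewrite /c /closer_pos mul2n -addnn -addSn leq_add //.
  by rewrite -[X in _ <= X](size_iota 0 n) count_size.
split=> //.
- apply: uniq_perm; rewrite ?iota_uniq //.
    rewrite cat_uniq !map_inj_in_uniq ?iota_uniq ?andbT /=.
    - apply/hasPn => _ /mapP[i + ->]; rewrite mem_iota => lti.
      by apply/mapP => -[j]; rewrite mem_iota => ltj /eqP; rewrite eq_sym (negbTE (oc_neq _ _)).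
    - by move=> i j; rewrite !mem_iota; apply: c_inj.
    - by move=> i j; rewrite !mem_iota; apply: o_inj.
  set s := _ ++ _; have Us : uniq s.
    rewrite cat_uniq !map_inj_in_uniq ?iota_uniq ?andbT /=.
    - apply/hasPn => _ /mapP[i + ->]; rewrite mem_iota => lti.
      by apply/mapP => -[j]; rewrite mem_iota => ltj /eqP; rewrite eq_sym (negbTE (oc_neq _ _)).
    - by move=> i j; rewrite !mem_iota; apply: c_inj.
    - by move=> i j; rewrite !mem_iota; apply: o_inj.
  have sub : {subset s <= iota 0 (2 * n)}.
    move=> v; rewrite !mem_iota mem_cat => /orP[] /mapP[i]; rewrite mem_iota => lti ->.
      by apply: ltn_trans (lt_oc _ lti) (lt_c2 _ lti).
    exact: lt_c2.
  have [] := uniq_min_size Us sub; last by [].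
  by rewrite size_cat !size_map !size_iota mul2n addnn.
(* A left nesting would force [l b < l a], since otherwise opener [a] would come first. Then a
   closer of the run [l b] would lie strictly between two adjacent openers. *)
- move=> a b lta ltb Eo; apply/negP => lt_c.
  have ltab : a < b.
    by case: (ltngtP a b) => // lt; [have := @c_incr b a; lia|move: lt_c; rewrite lt ltnn].
  have ltl : l b < l a.
    rewrite ltnNge leq_eqVlt orbC; apply/negP => lex.
    by have := o_lt lta ltb; rewrite ltab andbT Eo => /(_ lex); lia.
  have [i lei Ei] := code_fun_val lta (leq_trans (ltnW ltl) (lk lta)).
  have lti : i < n by apply: leq_ltn_trans lei lta.
  have : c i < o a by apply: co_lt; rewrite // Ei.
  have : o b < c i by apply: oc_lt; rewrite // Ei.
  by rewrite Eo; lia.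
Qed.

Lemma decoding_block i : i < n -> block_of c i = k i.
Proof.
elim: i => [|i IHi] lti; first by rewrite k0.
rewrite block_ofS IHi ?(ltnW lti) //.
case: (k_step lti) => Ek.
  by rewrite /c /closer_pos Ek addSn eqxx addn0.
(* When the block rises, surjectivity provides an opener labelled by the new block, which separates
   the two closers. *)
rewrite Ek; have [j ltj Ej] := l_surj lti.
suff : c i.+1 != (c i).+1 by move=> ->; rewrite addn1.
rewrite gtn_eqF // /c /closer_pos addSn ltnS ltn_add2l.
apply: (@ltn_count_iota _ _ _ j) => //=; first by move=> j' _; rewrite Ek; apply: leqW.
  by rewrite Ej.
by rewrite Ej Ek ltnn.
Qed.

(** Closer [N] is the first whose block is at least [l j]; as blocks rise by at most one, its block
    is [l j]. *)
Lemma decoding_label j : j < n -> label_of n o c j = l j.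
Proof.
move=> ltj; rewrite /label_of.
have -> : #{i < n | c i < o j} = #{i < n | k i < l j}.
  by apply: eq_count_iota => i lti; apply: decoding_closer_before.
have := closed_count ltj; set N := #{_ < _ | _} => leN.
have ltN : N < n by apply: leq_ltn_trans ltj.
rewrite decoding_block //.
have ge_N : l j <= k N.
  rewrite leqNgt; apply/negP => lt; suff : N.+1 <= N by rewrite ltnn.
  rewrite -[X in X <= _](count_iota_ltn ltN); apply: leq_count_iota => i _ leiN.
  by apply: leq_ltn_trans lt; apply: k_mono.
apply/eqP; rewrite eqn_leq ge_N andbT.
case: (posnP N) => [->|N_gt0]; first by rewrite k0.
have ltN1 : N.-1 < n by lia.
have lt_N1 : k N.-1 < l j.
  rewrite ltnNge; apply/negP => le; suff : N <= N.-1 by lia.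
  rewrite -[X in _ <= X](count_iota_ltn (ltnW ltN1)); apply: leq_count_iota => i lti lt.
  by rewrite ltnNge; apply/negP => leN1; have := k_mono leN1 lti; lia.
have := @k_step N.-1; rewrite prednK // => /(_ ltN); lia.
Qed.
End Decoding.
End ArcSystems.

(* [arc] alone would be the arcs of cyclic sequences of [path]. *)
Local Notation arc := Defs.arc.

(** * Matchings as arc systems *)

Section MatchingCodes.
Variable n : nat.
Implicit Types (A B : {set 'I_(2 * n)}) (M : {set {set 'I_(2 * n)}}).
Local Open Scope nat_scope.

Lemma bigmin_leq (I : eqType) (r : seq I) (P : pred I) (F : I -> nat) N i :
  i \in r -> P i -> \big[minn/N]_(j <- r | P j) F j <= F i.
Proof.
elim: r => // j r IHr; rewrite inE big_cons => /predU1P[<- ->|/IHr H /H le]; first exact: geq_minl.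
by case: ifP => // _; apply: leq_trans le; apply: geq_minr.
Qed.

Lemma bigmin_attained (I : eqType) (r : seq I) (P : pred I) (F : I -> nat) N :
  let m := \big[minn/N]_(j <- r | P j) F j in m = N \/ exists2 i, P i & F i = m.
Proof.
apply: (big_ind (fun m => m = N \/ exists2 i, P i & F i = m)); first by left.
  by move=> m1 m2 H1 H2; rewrite /minn; case: ifP.
by move=> i Pi; right; exists i.
Qed.

Lemma op_set2 (a b : 'I_(2 * n)) : a < b -> op [set a; b] = a.
Proof.
move=> ltab; rewrite /op.
have le_m (d : 'I_(2 * n)) : d \in [set a; b] ->
    \big[minn/(2 * n)]_(a0 in [set a; b]) (a0 : nat) <= d by exact: bigmin_leq (mem_index_enum d).
have := bigmin_attained (index_enum _) (mem [set a; b]) (fun d : 'I_(2 * n) => d : nat) (2 * n).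
have := le_m a; rewrite !inE eqxx => /(_ isT).
move=> lea [Em|[d]]; first by have := ltn_ord a; rewrite Em in lea; lia.
by rewrite /= !inE => /orP[/eqP->|/eqP->] //= E; move: lea; rewrite -E; lia.
Qed.

Lemma cl_set2 (a b : 'I_(2 * n)) : a < b -> cl [set a; b] = b.
Proof.
move=> ltab; rewrite /cl.
have leb : b <= \max_(d in [set a; b]) (d : nat) by apply: leq_bigmax_cond; rewrite !inE eqxx orbT.
have [|d] := @eq_bigmax_cond _ (mem [set a; b]) (fun d : 'I_(2 * n) => d : nat).
  by rewrite cards2 -val_eqE /= ltn_eqF.
by rewrite /= !inE => /orP[/eqP->|/eqP->] //= E; move: leb; rewrite E; lia.
Qed.

Definition arc_set (i j : nat) : {set 'I_(2 * n)} :=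
  [set x : 'I_(2 * n) | (x == i :> nat) || (x == j :> nat)].

Lemma arc_set_op_cl i j : i < j < 2 * n ->
  [/\ op (arc_set i j) = i, cl (arc_set i j) = j & #|arc_set i j| = 2].
Proof.
case/andP => ltij ltj; have lti := ltn_trans ltij ltj.
have -> : arc_set i j = [set Ordinal lti; Ordinal ltj] by apply/setP => x; rewrite !inE.
by rewrite op_set2 // cl_set2 // cards2 -val_eqE /= ltn_eqF.
Qed.

Section Arcs.
Variable M : {set {set 'I_(2 * n)}}.
Hypothesis matchingM : is_matching M.

Lemma matching_arc A : A \in M -> [/\ op A < cl A, cl A < 2 * n & A = arc_set (op A) (cl A)].
Proof.
move=> AM; have /andP[_ /forallP/(_ A)/implyP/(_ AM)/cards2P[a [b [neq_ab ->]]]] := matchingM.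
wlog ltab : a b neq_ab / a < b => [H|].
  case: (ltngtP a b) => [|lt|/val_inj E]; first exact: H.
    by rewrite setUC; apply: H; rewrite 1?eq_sym.
  by rewrite E eqxx in neq_ab.
by rewrite op_set2 // cl_set2 //; split=> //; apply/setP => x; rewrite !inE.
Qed.

Lemma card_matching : #|M| = n.
Proof.
have /andP[partM /forallP card2] := matchingM.
have := @card_uniform_partition _ 2 M setT (fun A AM => eqP (implyP (card2 A) AM)) partM.
by rewrite cardsT card_ord; lia.
Qed.

Let s := sort (fun A B => cl A <= cl B) (enum M).

Let size_s : size s = n. Proof. by rewrite size_sort -cardE card_matching. Qed.

Lemma arc_in i : i < n -> arc M i \in M.
Proof. by move=> lti; rewrite -mem_enum -(mem_sort (fun A B => cl A <= cl B)) mem_nth // size_s. Qed.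

Lemma arc_ex A : A \in M -> exists2 i, i < n & arc M i = A.
Proof.
rewrite -mem_enum -(mem_sort (fun A B => cl A <= cl B)) => As.
by exists (index A s); [rewrite -[X in _ < X]size_s index_mem | exact: nth_index].
Qed.

(** The [2 * n] openers and closers cover a ground set of the same size, so they do not repeat. *)
Lemma perm_op_cl : perm_eq (map (fun i => op (arc M i)) (iota 0 n) ++ map (fun i => cl (arc M i)) (iota 0 n))
  (iota 0 (2 * n)).
Proof.
set r := _ ++ _.
have sub : {subset iota 0 (2 * n) <= r}.
  move=> v; rewrite mem_iota => ltv; pose x := Ordinal (ltv : v < 2 * n).
  have /andP[/and3P[/eqP covM _ _] _] := matchingM.
  have : x \in cover M by rewrite covM inE.
  case/bigcupP => A AM; have [_ _ ->] := matching_arc AM; have [i lti <-] := arc_ex AM.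
  by rewrite inE mem_cat -[v]/(x : nat) => /orP[] /eqP ->; apply/orP; [left|right];
  apply/mapP; exists i; rewrite ?mem_iota.
have sz : size r <= size (iota 0 (2 * n)) by rewrite size_cat !size_map !size_iota mul2n addnn.
have Ur := leq_size_uniq (iota_uniq _ _) sub sz.
apply: uniq_perm => //; first exact: iota_uniq.
by have [] := uniq_min_size (iota_uniq _ _) sub sz => _ E v; rewrite E.
Qed.

Lemma cl_arc_mono i j : i < j < n -> cl (arc M i) < cl (arc M j).
Proof.
case/andP => ltij ltj; have lti := ltn_trans ltij ltj.
rewrite ltn_neqAle; apply/andP; split.
  have := perm_uniq perm_op_cl; rewrite iota_uniq cat_uniq => /and3P[_ _ U].
  have := nth_uniq 0 _ _ U; rewrite size_map size_iota => /(_ i j lti ltj).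
  by rewrite !(nth_map 0) ?size_iota // !nth_iota // !add0n => ->; rewrite ltn_eqF.
have tot : total (fun A B => cl A <= cl B) by move=> A B; apply: leq_total.
have tr : transitive (fun A B => cl A <= cl B) by move=> A B C; apply: leq_trans.
by apply: (sorted_ltn_nth tr set0 (sort_sorted tot _)) ltij; rewrite inE size_s.
Qed.
End Arcs.

Lemma matching_arc_system M : M \in no_left_nesting n ->
  arc_system n (fun i => op (arc M i)) (fun i => cl (arc M i)).
Proof.
rewrite inE => /andP[matchingM /forallP noLN]; split.
- exact: cl_arc_mono.
- by move=> i lti; have [] := matching_arc matchingM (arc_in matchingM lti).
- exact: perm_op_cl.
move=> i j lti ltj E; have /implyP/(_ (arc_in matchingM lti))/forallP/(_ (arc M j))/implyP := noLN (arc M i).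
move/(_ (arc_in matchingM ltj)); apply: contra => lt_c.
have [lt_oc _ _] := matching_arc matchingM (arc_in matchingM lti).
by apply/and4P; split; rewrite // E.
Qed.

Lemma arc_system_matching (o c : nat -> nat) : arc_system n o c ->
  exists2 M, M \in no_left_nesting n & forall i, i < n -> op (arc M i) = o i /\ cl (arc M i) = c i.
Proof.
move=> oc; have [c_incr lt_oc perm_oc noLN] := oc.
have ltc i : i < n -> c i < 2 * n.
  move=> lti; have := perm_mem perm_oc (c i); rewrite [RHS]mem_iota add0n /= => <-.
  by rewrite mem_cat map_f ?orbT // mem_iota.
pose a i := arc_set (o i) (c i); pose M := [set a (i : nat) | i : 'I_n].
have opcl i : i < n -> [/\ op (a i) = o i, cl (a i) = c i & #|a i| = 2].
  by move=> lti; apply: arc_set_op_cl; rewrite lt_oc // ltc.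
have MP A : A \in M -> exists2 i, i < n & A = a i by case/imsetP => i _ ->; exists i.
have aM i : i < n -> a i \in M by move=> lti; apply/imsetP; exists (Ordinal lti).
have c_inj i j : i < n -> j < n -> c i = c j -> i = j.
  move=> lti ltj E; case: (ltngtP i j) => // lt.
    by have := c_incr i j; rewrite E ltnn lt ltj => /(_ isT).
  by have := c_incr j i; rewrite E ltnn lt lti => /(_ isT).
have matchingM : is_matching M.
  apply/andP; split; last by apply/forallP => A; apply/implyP => /MP[i lti ->]; have [_ _ ->] := opcl i lti.
  have coverM : cover M = [set: 'I_(2 * n)].
    apply/setP => x; rewrite !inE; apply/bigcupP.
    have := perm_mem perm_oc (x : nat); rewrite [RHS]mem_iota add0n ltn_ord mem_cat.
    case/orP => /mapP[i]; rewrite mem_iota => lti E; exists (a i); rewrite ?aM // inE E eqxx //.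
    by rewrite orbT.
  rewrite /partition coverM eqxx /=; apply/andP; split; last first.
    by apply/negP => /MP[i lti E]; have [_ _] := opcl i lti; rewrite -E cards0.
  (* Disjointness follows by counting: [n] distinct arcs of size 2 cover [2 * n] points. *)
  rewrite /trivIset coverM cardsT card_ord.
  rewrite (eq_bigr (fun=> 2)) => [|A /MP[i lti ->]]; last by have [_ _ ->] := opcl i lti.
  rewrite sum_nat_const mulnC card_in_imset ?card_ord // => i j _ _ E.
  apply/val_inj/c_inj; rewrite ?ltn_ord //.
  by have [_ <- _] := opcl i (ltn_ord i); have [_ <- _] := opcl j (ltn_ord j); rewrite E.
exists M.
  rewrite inE matchingM; apply/forallP => A; apply/implyP => /MP[i lti ->].
  apply/forallP => B; apply/implyP => /MP[j ltj ->]; rewrite /left_nesting.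
  have [-> -> _] := opcl i lti; have [-> -> _] := opcl j ltj.
  apply/negP => /and4P[_ _ lt_c /eqP E]; have := noLN i j lti ltj E.
  by rewrite lt_c.
have sorted_incr (f : nat -> nat) :
    (forall i j, i < j < n -> f i < f j) -> sorted ltn [seq f i | i <- iota 0 n].
  move=> f_incr; apply: (@homo_sorted_in _ _ (fun i => i < n) f ltn ltn) (iota_ltn_sorted _ _).
    by move=> i j lti ltj ltij; apply: f_incr; apply/andP.
  by apply/allP => i; rewrite mem_iota.
(* Both lists of closers are strictly increasing with the same elements, so the numbering of the
   arcs agrees with that of [c]. *)
have Ecl : [seq cl (arc M i) | i <- iota 0 n] = [seq c i | i <- iota 0 n].
  apply: (irr_sorted_eq ltn_trans ltnn); [exact/sorted_incr/cl_arc_mono|exact: sorted_incr|].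
  move=> v; apply/mapP/mapP => -[i]; rewrite mem_iota => lti ->.
    have [j ltj ->] := MP _ (arc_in matchingM lti).
    by exists j; [rewrite mem_iota|have [_ -> _] := opcl j ltj].
  have [j ltj Ej] := arc_ex matchingM (aM i lti).
  by exists j; [rewrite mem_iota|rewrite Ej; have [_ -> _] := opcl i lti].
move=> i lti; have Ei : cl (arc M i) = c i.
  have := congr1 (fun r => nth 0 r i) Ecl; rewrite /= !(nth_map 0) ?size_iota //.
  by rewrite nth_iota.
split=> //; have [j ltj E] := MP _ (arc_in matchingM lti).
have [Eo Ec _] := opcl j ltj; move: Ei; rewrite E Ec Eo => /(c_inj _ _ ltj lti) -> //.
Qed.
End MatchingCodes.

(** * The bijection between matchings without left nestings and surjective codes *)

Definition code_of n (k l : nat -> nat) : seq (nat * nat) := [seq (k i, l i) | i <- iota 0 n].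

Section CodeOf.
Local Open Scope nat_scope.

Lemma nth_code_of n k l i : i < n -> nth (0, 0) (code_of n k l) i = (k i, l i).
Proof. by move=> lti; rewrite (nth_map 0) ?size_iota // nth_iota. Qed.

Lemma code_of_codes n k l : code_fun n.+1 k l ->
  code_of n.+1 k l \in codes n.+1 /\ surjective_code (code_of n.+1 k l).
Proof.
move=> kl; have [k0 step lk surj] := kl.
have sz : size (code_of n.+1 k l) = n.+1 by rewrite size_map size_iota.
have nthE i := @nth_code_of n.+1 k l i.
split.
  apply/codesP; split=> //; split=> [|i|i]; rewrite ?sz.
  - by rewrite nthE.
  - by move=> lti; rewrite !nthE ?(ltnW lti) //=; apply: step.
  - by move=> lti; rewrite nthE //=; apply: lk.
apply/allP => v; rewrite mem_iota ltnS -nth_last sz nthE //= => lev.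
have [i lei <-] := code_fun_val kl (ltnSn n) lev.
have [j ltj <-] := surj i lei.
change (l j \in code_labels (code_of n.+1 k l)).
apply/mapP; exists (k j, l j) => //; apply/mapP; exists j => //.
by rewrite mem_iota.
Qed.

Lemma code_fun_codes n c : c \in codes n.+1 -> surjective_code c ->
  code_fun n.+1 (fun i => block c i) (fun i => label c i).
Proof.
case/codesP => sz Vc /allP surj; have [b0 step lb] := Vc; rewrite sz in step lb.
split=> // i lti; have /surj/mapP[v /(nthP (0, 0))[j ltj <-] ->] : block c i \in iota 0 (last (0, 0) c).1.+1.
  by rewrite mem_iota ltnS -nth_last sz /=; apply: block_mono; rewrite // sz -ltnS lti ltnSn.
by exists j; rewrite // -sz.
Qed.

Lemma code_of_nth n c : size c = n -> code_of n (fun i => block c i) (fun i => label c i) = c.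
Proof.
move=> sz; apply: (@eq_from_nth _ (0, 0)); rewrite size_map size_iota // => i lti.
by rewrite nth_code_of //; case: (nth _ _ _).
Qed.

Lemma eq_code_of n k l k' l' : (forall i, i < n -> k i = k' i) -> (forall i, i < n -> l i = l' i) ->
  code_of n k l = code_of n k' l'.
Proof. by move=> Ek El; apply/eq_in_map => i; rewrite mem_iota => lti; rewrite Ek ?El. Qed.

Lemma eq_block_of n c c' : (forall i, i < n -> c i = c' i) -> forall i, i < n -> block_of c i = block_of c' i.
Proof.
move=> E i lti; apply: eq_count_iota => j ltj; rewrite !E //; first exact: ltn_trans lti.
exact: leq_ltn_trans lti.
Qed.

Lemma eq_closer_pos n k l k' l' i : (forall i, i < n -> k i = k' i) -> (forall i, i < n -> l i = l' i) ->
  i < n -> closer_pos n k l i = closer_pos n k' l' i.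
Proof.
move=> Ek El lti; rewrite /closer_pos; congr (_ + _).
by apply: eq_count_iota => j ltj; rewrite Ek // El.
Qed.

Lemma eq_opener_pos n k l k' l' i : (forall i, i < n -> k i = k' i) -> (forall i, i < n -> l i = l' i) ->
  i < n -> opener_pos n k l i = opener_pos n k' l' i.
Proof.
move=> Ek El lti; rewrite /opener_pos; congr (_ + _);
by apply: eq_count_iota => j ltj; rewrite ?Ek // !El.
Qed.

Definition matching_code n (M : {set {set 'I_(2 * n)}}) : seq (nat * nat) :=
  let o i := op (arc M i) in let c i := cl (arc M i) in
  code_of n (block_of c) (label_of n o c).

(** Blocks and labels determine the opener and closer positions, and these determine the arcs. *)
Lemma matching_code_inj n : {in no_left_nesting n &, injective (@matching_code n)}.
Proof.
have sub M M' : M \in no_left_nesting n -> M' \in no_left_nesting n ->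
    matching_code M = matching_code M' -> M \subset M'.
  move=> HM HM' E; have oc := matching_arc_system HM; have oc' := matching_arc_system HM'.
  pose k N := block_of (fun i => cl (arc (N : {set {set 'I_(2 * n)}}) i)).
  pose l N := label_of n (fun i => op (arc (N : {set {set 'I_(2 * n)}}) i)) (fun i => cl (arc N i)).
  have Enth i : i < n -> (k M i, l M i) = (k M' i, l M' i).
    by move=> lti; have := congr1 (fun c => nth (0, 0) c i) E; rewrite /= !nth_code_of.
  have Ek i (lti : i < n) := congr1 fst (Enth i lti).
  have El i (lti : i < n) := congr1 snd (Enth i lti).
  rewrite /= in Ek El.
  have mM : is_matching M by move: HM; rewrite inE => /andP[].
  have mM' : is_matching M' by move: HM'; rewrite inE => /andP[].
  apply/subsetP => A /(arc_ex mM)[i lti <-].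
  have [_ _ ->] := matching_arc mM (arc_in mM lti).
  rewrite -(opener_posE oc lti) -(closer_posE oc lti).
  rewrite (eq_opener_pos Ek El lti) (eq_closer_pos Ek El lti) opener_posE // closer_posE //.
  by have [_ _ <-] := matching_arc mM' (arc_in mM' lti); apply: arc_in.
by move=> M M' HM HM' E; apply/eqP; rewrite eqEsubset !sub.
Qed.

(** For surjectivity, a code is decoded into an arc system, realized by a matching, and encoded
    again. *)
Lemma matching_code_perm n :
  perm_eq [seq matching_code M | M <- enum (no_left_nesting n.+1)]
          [seq c <- codes n.+1 | surjective_code c].
Proof.
apply: uniq_perm.
- rewrite map_inj_in_uniq ?enum_uniq // => M M'; rewrite !mem_enum.
  exact: matching_code_inj.
- by rewrite filter_uniq // codes_uniq.
move=> c; rewrite mem_filter; apply/mapP/andP => [[M]|[surj cin]].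
  rewrite mem_enum => HM ->.
  by have [-> ->] := code_of_codes (encoding_code_fun (matching_arc_system HM)).
have kl := code_fun_codes cin surj.
have [M HM EM] := arc_system_matching (decoding_arc_system kl).
exists M; rewrite ?mem_enum //.
have [sz _] := codesP _ _ cin.
rewrite -[LHS](code_of_nth sz); apply: eq_code_of => i lti.
  rewrite -[LHS](decoding_block kl) //; apply: eq_block_of lti => j ltj.
  by have [_ ->] := EM j ltj.
rewrite -[LHS](decoding_label kl) // /label_of.
have -> : count (fun j => cl (arc M j) < op (arc M i)) (iota 0 n.+1) =
  count (fun j => closer_pos n.+1 (fun i => block c i) (fun i => label c i) j <
                  opener_pos n.+1 (fun i => block c i) (fun i => label c i) i) (iota 0 n.+1).
  by apply: eq_count_iota => j ltj; have [_ ->] := EM j ltj; have [-> _] := EM i lti.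
apply: (@eq_block_of n.+1) => [j ltj|]; first by have [_ ->] := EM j ltj.
exact: leq_ltn_trans (closed_runs_leq (decoding_arc_system kl) lti) lti.
Qed.
End CodeOf.

(** An opener precedes the first closer exactly when its label is 0, and successive closers are
    adjacent exactly when they share a block. Then descents of labels are nestings, plateaus are
    crossings with adjacent openers, and ascents are the other crossings. *)
Lemma matching_code_weight (R : fieldType) (x y z s : R) n (M : {set {set 'I_(2 * n.+1)}}) :
  M \in no_left_nesting n.+1 ->
  code_weight x y z s (matching_code M) =
  s ^+ min_stat M * (x ^+ #|Rne M| * y ^+ #|Rcr0 M| * z ^+ #|LRcr M|).
Proof.
move=> HM; have oc := matching_arc_system HM.
pose o i := op (arc M i); pose c i := cl (arc M i); rewrite -/o -/c in oc.
pose k := block_of c; pose l := label_of n.+1 o c.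
have -> : code_weight x y z s (matching_code M) = \prod_(i < n.+1)
   ((if l i == 0%N then s else 1) *
    (if (0 < i)%N && (k i == k i.-1) then step_weight x y z (l i.-1) (l i) else 1)).
  rewrite /code_weight [size _]size_map size_iota; apply: eq_bigr => i _.
  rewrite !nth_code_of //; last by have := ltn_ord i; lia.
rewrite -!prod_indicator -!big_split; apply: eq_bigr => -[i lti] _; congr (_ * _).
  rewrite inE [op _]/(o i) [cl _]/(c 0%N); congr (if _ then _ else _).
  have lt0 : (0 < n.+1)%N by [].
  rewrite ltn_neqAle (opener_neq_closer oc) //= leqNgt (closer_before oc) //.
  by rewrite -leqNgt leqn0.
rewrite /Rcr0 !inE /= /adjacent_closers /= -/(o i) -/(o i.-1) -/(c i) -/(c i.-1).
case: i lti => [|i] lti /=; first by rewrite !mulr1.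
have lti' := ltnW lti.
have -> : (k i.+1 == k i) = ((c i).+1 == c i.+1).
  by rewrite /k block_ofS -[X in _ == X]addn0 eqn_add2l eqb0 negbK eq_sym.
case: eqP => [Ec|_] /=; last by rewrite !mulr1.
have [_ lt_oc _ _] := oc.
have lto : (o i.+1 < c i)%N.
  have := lt_oc _ lti; rewrite -Ec ltnS leq_eqVlt.
  by rewrite (negbTE (opener_neq_closer oc _ _)).
rewrite lt_oc // lto !andbT (consecutive_openers oc lti) !(opener_before oc) //.
rewrite -!/(l _) [(i.+1 < i)%N]ltnNge leqnSn andbF orbF ltnSn andbT /step_weight.
by case: (ltngtP (l i) (l i.+1)) => _ /=; ring.
Qed.

Lemma matching_sum_catalytic (R : fieldType) (x y z s : R) n : [pchar R] =i pred0 ->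
  \sum_(M in no_left_nesting n.+1)
     s ^+ min_stat M * (x ^+ #|Rne M| * y ^+ #|Rcr0 M| * z ^+ #|LRcr M|) =
  catalytic (x - 1) (y - 1) (z - 1) s true n.+1 1 1.
Proof.
move=> R0; rewrite -code_sum_catalytic // -[RHS]big_filter -(perm_big _ (matching_code_perm n)) big_map.
rewrite [RHS]big_enum; apply: eq_bigr => M HM.
by rewrite matching_code_weight.
Qed.

Lemma card_Rcr n (M : {set {set 'I_(2 * n)}}) : #|Rcr M| = (#|Rcr0 M| + #|LRcr M|)%N.
Proof.
have sub : LRcr M \subset Rcr M.
  apply/subsetP => i; rewrite !inE => /andP[-> /andP[/eqP <- ->]].
  by rewrite ltnSn.
by rewrite /Rcr0 -(cardsID (LRcr M) (Rcr M)) (setIidPr sub) addnC.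
Qed.

(** * Specialization to rational functions and the final identities *)

Lemma pchar_ratfun : [pchar ratfun] =i pred0.
Proof.
apply/pcharf0P => n.
rewrite -(rmorph_nat (@FracField.tofrac {mpoly int[4]})) tofrac_eq0.
by rewrite -(rmorph_nat (@mpolyC 4 int)) mpolyC_eq0 Num.Theory.pnatr_eq0.
Qed.

Lemma var_inj : injective var.
Proof.
move=> i j /eqP; rewrite tofrac_eq => /eqP /(congr1 (mcoeff U_(i))) /eqP.
by rewrite !mcoeffXU eqxx [j == i]eq_sym; case: (i =P j) => // _; rewrite mulr1n mulr0n oner_eq0.
Qed.

Lemma var_neq1 i : var i != 1.
Proof.
rewrite -tofrac1 tofrac_eq; apply/eqP => /(congr1 (mcoeff U_(i))) /eqP.
by rewrite mcoeffXU eqxx mcoeff1 mnm1_eq0 mulr1n mulr0n oner_eq0.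
Qed.

Lemma eq_fps_sum1 (R : zmodType) (F F' : nat -> fps R) S :
  F =1 F' -> fps_sum1_eq F S -> fps_sum1_eq F' S.
Proof.
move=> EF H n; have [N0 HN] := H n; exists N0 => N /HN <-.
by under [in RHS]eq_bigr do rewrite EF.
Qed.

Lemma fps_sum1_unique (R : zmodType) (F : nat -> fps R) S S' :
  fps_sum1_eq F S -> fps_sum1_eq F S' -> S = S'.
Proof.
move=> H H'; apply: fpsP => n; have [N HN] := H n; have [N' HN'] := H' n.
by rewrite -(HN (maxn N N')) ?leq_maxl // HN' ?leq_maxr.
Qed.

Lemma eq_series1 (V : nmodType) (a b : nat -> V) :
  (forall n, a n.+1 = b n.+1) -> series1 a = series1 b.
Proof. by move=> E; apply: fpsP => -[|n] /=. Qed.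

Lemma letters_unmarked (R : fieldType) (x y z : R) k : (0 < k)%N ->
  letters x y z 1 k = (1 + ((x - y) *: fps_t) / (1 - (z - y) *: fps_t)) ^+ k.
Proof. by case: k => // k _; rewrite /letters scale1r mulr1 -scalerAl -exprSr. Qed.

Lemma letters_uniform (R : fieldType) (x y s : R) k :
  letters x y y s k = (1 + (x - y) *: fps_t) ^+ k.-1 * (1 + ((x - y) * s) *: fps_t).
Proof. by rewrite /letters subrr mul0r !scale0r subr0 !divr1 scalerA. Qed.

Theorem theorem8p1 :
  let x := vx in let y := vy in let z := vz in let s := vs in
  let t : fps ratfun := fps_t in
  ([/\ series1 (fun n => \sum_(p : 'S_n)
          x ^+ perm_p p * y ^+ perm_q p * z ^+ asc_short p)
     = series1 (fun n => \sum_(M in no_left_nesting n)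
          x ^+ #|Rne M| * y ^+ #|Rcr0 M| * z ^+ #|LRcr M|)
   & fps_sum1_eq
       (fun m => \prod_(1 <= k < m.+1)
          ((y - 1)^-1 *:
            ((1 - ((y - 1) / (x - y)) *:
                 ((1 + ((x - y) *: t) / (1 - (z - y) *: t)) ^+ k - 1))^-1 - 1)))
       (series1 (fun n => \sum_(M in no_left_nesting n)
          x ^+ #|Rne M| * y ^+ #|Rcr0 M| * z ^+ #|LRcr M|))])
  /\
  ([/\ series1 (fun n => \sum_(p : 'S_n)
          s ^+ rmin p * x ^+ perm_p p * y ^+ (perm_q p + asc_short p))
     = series1 (fun n => \sum_(p : 'S_n)
          s ^+ rmin p * x ^+ p_silly p * y ^+ q_silly p),
     series1 (fun n => \sum_(p : 'S_n)
          s ^+ rmin p * x ^+ p_silly p * y ^+ q_silly p)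
     = series1 (fun n => \sum_(M in no_left_nesting n)
          s ^+ min_stat M * x ^+ #|Rne M| * y ^+ #|Rcr M|)
   & fps_sum1_eq
       (fun m => \prod_(1 <= k < m.+1)
          ((y - 1)^-1 *:
            ((1 - ((y - 1) / (x - y)) *:
                 ((1 + (x - y) *: t) ^+ k.-1 * (1 + ((x - y) * s) *: t) - 1))^-1
             - 1)))
       (series1 (fun n => \sum_(M in no_left_nesting n)
          s ^+ min_stat M * x ^+ #|Rne M| * y ^+ #|Rcr M|))]).
Proof.
move=> x y z s t; have R0 := pchar_ratfun.
have neq_xy : x != y by rewrite (inj_eq var_inj) -val_eqE /= !inordK.
have neq_y1 : y != 1 := var_neq1 _.
have perm1 n : \sum_(p : 'S_n.+1) x ^+ perm_p p * y ^+ perm_q p * z ^+ asc_short p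
    = catalytic (x - 1) (y - 1) (z - 1) 1 false n.+1 1 1.
  by rewrite -perm_sum_catalytic //; apply: eq_bigr => p _; rewrite expr1n mul1r.
have match1 n : \sum_(M in no_left_nesting n.+1) x ^+ #|Rne M| * y ^+ #|Rcr0 M| * z ^+ #|LRcr M|
    = catalytic (x - 1) (y - 1) (z - 1) 1 true n.+1 1 1.
  by rewrite -matching_sum_catalytic //; apply: eq_bigr => M _; rewrite expr1n mul1r.
have match2 n : \sum_(M in no_left_nesting n.+1) s ^+ min_stat M * x ^+ #|Rne M| * y ^+ #|Rcr M|
    = catalytic (x - 1) (y - 1) (y - 1) s true n.+1 1 1.
  rewrite -matching_sum_catalytic //; apply: eq_bigr => M _.
  by rewrite card_Rcr exprD !mulrA.
have perm2 n : \sum_(p : 'S_n.+1) s ^+ rmin p * x ^+ perm_p p * y ^+ (perm_q p + asc_short p)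
    = catalytic (x - 1) (y - 1) (y - 1) s false n.+1 1 1.
  rewrite -perm_sum_catalytic //; apply: eq_bigr => p _.
  by rewrite exprD !mulrA.
have silly2 n : \sum_(p : 'S_n.+1) s ^+ rmin p * x ^+ p_silly p * y ^+ q_silly p
    = catalytic (x - 1) (y - 1) (y - 1) s false n.+1 1 1.
  by rewrite -silly_sum_catalytic //; apply: eq_bigr => p _; rewrite mulrA.
split; split.
(* The sums for [e = false] and [e = true] have the same closed form, so the two series agree by
   uniqueness of the limit. *)
- exact: fps_sum1_unique (catalytic_series neq_xy neq_y1 perm1) (catalytic_series neq_xy neq_y1 match1).
- apply: eq_fps_sum1 (catalytic_series neq_xy neq_y1 match1) => m.
  by apply: eq_big_nat => k /andP[k_gt0 _]; rewrite /block_series letters_unmarked.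
- by apply: eq_series1 => n; rewrite perm2 silly2.
- exact: fps_sum1_unique (catalytic_series neq_xy neq_y1 silly2) (catalytic_series neq_xy neq_y1 match2).
apply: eq_fps_sum1 (catalytic_series neq_xy neq_y1 match2) => m.
by apply: eq_big_nat => k /andP[k_gt0 _]; rewrite /block_series letters_uniform.
Qed.
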